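(* Let $r>0$ and let $f:C^0([-r,0];\mathbb{R}^n)\to\mathbb{R}^n$ satisfy $f(0)=0$ and be Lipschitz on bounded sets of $C^0([-r,0];\mathbb{R}^n)$. Let $p\in(1,+\infty]$ and let $X$ denote the Sobolev space $W^{1,p}([-r,0])$ or the Hölder space $C^{0,1-1/p}([-r,0])$. Suppose that for every $x_0\in C^{0,1-1/p}([-r,0])$ the solution $x(t)\in\mathbb{R}^n$ of $\dot x(t)=f(x_t)$ with initial condition $x_0$ exists for all $t\ge0$. Then for the system $\dot x(t)=f(x_t)$, property (GAS-X) holds if and only if property (UGAS-X) holds.
   Context: $|\cdot|$ is the Euclidean norm on $\mathbb{R}^n$ and $\mathbb{R}_+=[0,+\infty)$. $C^0([-r,0];\mathbb{R}^n)$ is the space of continuous functions with norm $\|x\|_\infty=\max_{s\in[-r,0]}|x(s)|$. $f$ is Lipschitz on bounded sets of $C^0([-r,0];\mathbb{R}^n)$ if there is a non-decreasing function $L:\mathbb{R}_+\to\mathbb{R}_+$ such that for every $R\ge 0$, $|f(x)-f(y)|\le L(R)\|x-y\|_\infty$ for all $x,y$ with $\|x\|_\infty\le R$, $\|y\|_\infty\le R$. For the system $\dot x(t)=f(x_t)$, $x(t)\in\mathbb{R}^n$ and $x_t\in C^0([-r,0];\mathbb{R}^n)$ is defined by $x_t(s)=x(t+s)$, $s\in[-r,0]$. For $x_0\in C^0([-r,0];\mathbb{R}^n)$, $\phi(t,x_0)$ denotes $x_t$, where $x(t)$ is the (unique, maximally defined for $t\ge0$) solution with initial condition $x_0$. Function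 spaces ($1/p:=0$ when $p=+\infty$). $W^{1,p}([-r,0])$ is the space of absolutely continuous $x:[-r,0]\to\mathbb{R}^n$ with $\dot x\in L^p((-r,0);\mathbb{R}^n)$, with norm $\|x\|_X=\|x\|_\infty+\|\dot x\|_p$, where $\|\dot x\|_p=(\int_{-r}^0|\dot x(s)|^p ds)^{1/p}$ for $p<+\infty$ and the essential supremum of $|\dot x|$ for $p=+\infty$. For $a\in(0,1]$, $C^{0,a}([-r,0])$ is the space of $x\in C^0([-r,0];\mathbb{R}^n)$ with $\sup_{t,s\in[-r,0],t\ne s}|x(t)-x(s)|/|t-s|^a<+\infty$, with norm $\|x\|_X=\max\left(\|x\|_\infty,\sup_{t\ne s}|x(t)-x(s)|/|t-s|^a\right)$. If $x_0\in X$, with $X$ one of these spaces, then $\phi(t,x_0)\in X$ whenever it exists. Class $K$: strictly increasing continuous functions $\rho:\mathbb{R}_+\to\mathbb{R}_+$ with $\rho(0)=0$. Class $KL$: functions $\sigma:\mathbb{R}_+\times\mathbb{R}_+\to\mathbb{R}_+$ such that $\sigma(\cdot,t)$ is of class $K$ for each $t\ge0$, and $\sigma(s,\cdot)$ is non-increasing with $\lim_{t\to+\infty}\sigma(s,t)=0$ for each $s\ge0$. (LS-X): for every $\varepsilon>0$ there exists $\delta(\varepsilon)>0$ such that $\sup\{\|\phi(t,x_0)\|_X: t\ge0,\ x_0\in X,\ \|x_0\|_X\le\delta(\varepsilon)\}\le\varepsilon$. (GA-X): for every $x_0\in X$, $\lim_{t\to+\infty}\|\phi(t,x_0)\|_X=0$.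 (GAS-X): both (LS-X) and (GA-X) hold. (UGAS-X): there exists $\sigma\in KL$ such that $\|\phi(t,x_0)\|_X\le\sigma(\|x_0\|_X,t)$ for all $t\ge0$ and all $x_0\in X$. *)

(* Defs.v *)
From HB Require Import structures.
From mathcomp Require Import all_boot all_order all_algebra.
From mathcomp Require Import all_classical all_reals all_analysis.

Set Implicit Arguments.
Unset Strict Implicit.
Unset Printing Implicit Defensive.

Import Order.TTheory GRing.Theory Num.Theory.
Import numFieldNormedType.Exports.

Local Open Scope classical_set_scope.
Local Open Scope ring_scope.

Section Spaces.
Context {R : realType} {n : nat}.
Implicit Types (r a : R) (p : \bar R) (x : R -> 'rV[R]_n).

(* Euclidean norm; the canonical norm `|v| on 'rV[R]_n is the max norm. *)
Definition enorm (v : 'rV[R]_n) : R := Num.sqrt (\sum_i v 0 i ^+ 2).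

(* A function on [-r, 0] is represented by a function x : R -> 'rV[R]_n of
   which only the values on [-r, 0] are relevant: every notion below depends
   only on these values.  All norms take values in [0, +oo]. *)
Definition C0 r : set (R -> 'rV[R]_n) :=
  [set x | {within `[- r, 0], continuous x}].

Definition supnorm r x : \bar R :=
  ereal_sup [set (enorm (x s))%:E | s in `[- r, 0]].

Definition abs_continuous r x : Prop :=
  forall e : R, 0 < e -> exists2 d : R, 0 < d &
    forall (k : nat) (u v : 'I_k -> R),
      (forall i, [/\ - r <= u i, u i <= v i & v i <= 0]) ->
      trivIset setT (fun i => `]u i, v i[%classic) ->
      \sum_i (v i - u i) < d ->
      \sum_i enorm (x (v i) - x (u i)) < e.

(* L^p((-r, 0)) norm of the derivative; extending a function by 0 outside
   (-r, 0) does not change its L^p norm, including for p = +oo. *)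
Definition deriv_Lnorm r p x : \bar R :=
  Lnorm lebesgue_measure p
    ((fun s => (enorm (derive1 x s))%:E) \_ `]- r, 0[).

(* An absolutely continuous function is derivable only almost everywhere;
   derive1 x is the derivative of x wherever the latter exists. *)
Definition deriv_in_Lp r p x : Prop :=
  [/\ {ae lebesgue_measure, forall s, s \in `]- r, 0[ -> derivable x s 1},
      (forall i, measurable_fun `]- r, 0[ (fun s => derive1 x s 0 i))
    & (deriv_Lnorm r p x < +oo)%E].

Definition holder_seminorm r a x : \bar R :=
  ereal_sup [set (enorm (x st.1 - x st.2) / `|st.1 - st.2| `^ a)%:E |
    st in [set st : R * R |
      [/\ st.1 \in `[- r, 0], st.2 \in `[- r, 0] & st.1 != st.2]]].

Record fun_space := FunSpace {
  carrier : set (R -> 'rV[R]_n);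
  space_norm : (R -> 'rV[R]_n) -> \bar R }.

Definition sobolev r p : fun_space :=
  FunSpace [set x | abs_continuous r x /\ deriv_in_Lp r p x]
    (fun x => supnorm r x + deriv_Lnorm r p x)%E.

Definition holder r a : fun_space :=
  FunSpace [set x | C0 r x /\ (holder_seminorm r a x < +oo)%E]
    (fun x => maxe (supnorm r x) (holder_seminorm r a x)).

End Spaces.

Arguments fun_space : clear implicits.

(* The exponent 1 - 1/p, with 1/p = 0 for p = +oo. *)
Definition holder_exponent {R : realType} (p : \bar R) : R :=
  match p with q%:E => 1 - q^-1 | _ => 1 end.

Section System.
Context {R : realType} {n : nat}.
Implicit Types (r : R) (f : (R -> 'rV[R]_n) -> 'rV[R]_n)
  (x : R -> 'rV[R]_n) (X : fun_space R n).

(* Together with the representation of C^0([-r, 0]), this condition forces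
   f x to depend only on the values of x on [-r, 0]. *)
Definition lipschitz_on_bounded r f : Prop :=
  exists L : R -> R,
    [/\ forall M : R, 0 <= M -> 0 <= L M,
        forall M N : R, 0 <= M -> M <= N -> L M <= L N
      & forall M : R, 0 <= M -> forall x y, C0 r x -> C0 r y ->
          (supnorm r x <= M%:E)%E -> (supnorm r y <= M%:E)%E ->
          ((enorm (f x - f y))%:E <= (L M)%:E * supnorm r (x - y)%R)%E].

Definition history x (t : R) : R -> 'rV[R]_n := fun s => x (t + s).

(* Solution on [-r, +oo), with a right derivative at t = 0. *)
Definition solution r f (x0 x : R -> 'rV[R]_n) : Prop :=
  [/\ forall s : R, s \in `[- r, 0] -> x s = x0 s,
      {within `[- r, +oo[, continuous x},
      h^-1 *: (x h - x 0) @[h --> 0^'+] --> f (history x 0)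
    & forall t : R, 0 < t -> is_derive t 1 x (f (history x t))].

(* phi r f t x0 is x_t for the (unique) solution x on [-r, +oo) starting from
   x0, whenever such a global solution exists. *)
Definition phi r f (t : R) (x0 : R -> 'rV[R]_n) : R -> 'rV[R]_n :=
  history (xget (cst 0) [set x | solution r f x0 x]) t.

Definition classK (rho : R -> R) : Prop :=
  [/\ rho 0 = 0,
      forall s t : R, 0 <= s -> s < t -> rho s < rho t
    & {within `[0, +oo[, continuous rho}].

Definition classKL (sigma : R -> R -> R) : Prop :=
  (forall t : R, 0 <= t -> classK (sigma ^~ t)) /\
  (forall s : R, 0 <= s ->
    (forall t u : R, 0 <= t -> t <= u -> sigma s u <= sigma s t) /\
    sigma s t @[t --> +oo] --> 0).

Definition LS r f X : Prop :=
  forall e : R, 0 < e -> exists2 d : R, 0 < d &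
    (ereal_sup [set y | exists (t : R) x0, [/\ (0 <= t)%R, carrier X x0,
        space_norm X x0 <= d%:E & y = space_norm X (phi r f t x0)]]
      <= e%:E)%E.

Definition GA r f X : Prop :=
  forall x0, carrier X x0 ->
    space_norm X (phi r f t x0) @[t --> +oo%R] --> 0%E.

Definition GAS r f X : Prop := LS r f X /\ GA r f X.

(* fine is harmless here: elements of X have a finite norm. *)
Definition UGAS r f X : Prop :=
  exists2 sigma : R -> R -> R, classKL sigma &
    forall (t : R) x0, 0 <= t -> carrier X x0 ->
      (space_norm X (phi r f t x0)
        <= (sigma (fine (space_norm X x0)) t)%:E)%E.

End System.

(* Main.v *)
Require Import Defs.
From mathcomp Require Import all_boot all_order all_algebra.
From mathcomp Require Import all_classical all_reals all_analysis.
From HB Require Import structures.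
From mathcomp Require Import measurable_realfun ess_sup_inf ring lra.

Import Order.TTheory GRing.Theory Num.Theory.
Import numFieldNormedType.Exports.

Local Open Scope classical_set_scope.
Local Open Scope ring_scope.

(** UGAS trivially gives GAS: continuity of sigma(., 0) at 0 yields stability
    and sigma(s, t) -> 0 yields attraction.  The content is the converse, where
    attraction must be made uniform over a ball of X.

    Compactness replaces uniformity.  Since p > 1, the exponent a = 1 - 1/p is
    positive and a ball of X is a set of bounded, uniformly a-Hoelder functions
    ([space_holder_ball]; for the Sobolev space this is the estimate
    |x(t) - x(s)| <= ||x'||_p |t - s|^a of [sobolev_holder_ball]).  The Hoelder
    ball is compact for uniform convergence, and Gronwall's inequality
    ([continuous_dependence]) makes solutions depend continuously, for uniform
    convergence, on their initial data.

    A limit point of a ball of W^(1,p) in C^0 is only known to be Hoelder, so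
    attraction in X says nothing about it directly.  But the equation smooths:
    after time r the state is C^1, hence lies in X whatever the initial Hoelder
    function was ([smooth_history], [GA_holder]), and from then on its X-norm is
    controlled by the supremum of |x| over a window of length 2r.  Thus every
    point x0 of the compact Hoelder ball has a C^0 neighbourhood and a time at
    which all solutions starting from that neighbourhood enter the small X-ball
    given by stability.  Finitely many neighbourhoods suffice, which gives a
    uniform attraction time ([uniform_attraction]); the same covering argument
    bounds all trajectories from a ball ([uniform_bound]).  The X-norm on the
    initial period [0, r], when the state still contains a piece of x0, is
    bounded by gluing ([history_space_bound]), which for the Sobolev norm uses
    the translation invariance of Lebesgue measure and Minkowski's inequality.

    It remains to dominate the worst overshoot m(s, t), which is monotone in s
    and in t and tends to 0 both as s -> 0 and as t -> +oo, by a function of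
    class KL ([kl_majorant_classKL]). *)

(** * The Euclidean norm *)

Section EuclideanNorm.
Context {R : realType} {n : nat}.
Implicit Types u v w : 'rV[R]_n.

Lemma sum_sqr_ge0 v : 0 <= \sum_i v 0 i ^+ 2.
Proof. by apply: sumr_ge0 => i _; exact: sqr_ge0. Qed.

Lemma enorm_ge0 v : 0 <= enorm v.
Proof. exact: sqrtr_ge0. Qed.

Lemma enorm_sqr v : enorm v ^+ 2 = \sum_i v 0 i ^+ 2.
Proof. by rewrite sqr_sqrtr ?sum_sqr_ge0. Qed.

Lemma enormZ (k : R) v : enorm (k *: v) = `|k| * enorm v.
Proof.
rewrite /enorm -sqrtr_sqr -sqrtrM ?sqr_ge0// mulr_sumr; congr Num.sqrt.
by apply: eq_bigr => i _; rewrite mxE exprMn.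
Qed.

Lemma enormN v : enorm (- v) = enorm v.
Proof. by rewrite -scaleN1r enormZ normrN1 mul1r. Qed.

Lemma enorm0 : enorm (0 : 'rV[R]_n) = 0.
Proof. by rewrite -(scale0r (0 : 'rV[R]_n)) enormZ normr0 mul0r. Qed.

Lemma enormBC u v : enorm (u - v) = enorm (v - u).
Proof. by rewrite -enormN opprB. Qed.

Lemma coord_le_enorm v i : `|v 0 i| <= enorm v.
Proof.
rewrite -sqrtr_sqr ler_sqrt ?sum_sqr_ge0// (bigD1 i)//= lerDl.
by apply: sumr_ge0 => j _; exact: sqr_ge0.
Qed.

Lemma enorm_eq0 v : enorm v = 0 -> v = 0.
Proof.
move=> v0; apply/rowP => i; rewrite mxE; apply/eqP; rewrite -normr_le0.
by rewrite -v0 coord_le_enorm.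
Qed.

Lemma cauchy_schwarz u v : \sum_i u 0 i * v 0 i <= enorm u * enorm v.
Proof.
have [u0|u0] := eqVneq (enorm u) 0.
  rewrite u0 mul0r big1// => i _.
  by rewrite (enorm_eq0 _ u0) mxE mul0r.
have [v0|v0] := eqVneq (enorm v) 0.
  rewrite v0 mulr0 big1// => i _.
  by rewrite (enorm_eq0 _ v0) mxE mulr0.
have up : 0 < enorm u by rewrite lt0r u0 enorm_ge0.
have vp : 0 < enorm v by rewrite lt0r v0 enorm_ge0.
(* Expand the squared norm of |v| u - |u| v. *)
suff : 0 <= 2 * enorm u * enorm v * (enorm u * enorm v - \sum_i u 0 i * v 0 i).
  by rewrite pmulr_rge0 ?subr_ge0// !mulr_gt0.
have : 0 <= \sum_i (enorm v * u 0 i - enorm u * v 0 i) ^+ 2.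
  by apply: sumr_ge0 => i _; exact: sqr_ge0.
suff -> : \sum_i (enorm v * u 0 i - enorm u * v 0 i) ^+ 2 =
  2 * enorm u * enorm v * (enorm u * enorm v - \sum_i u 0 i * v 0 i) by [].
rewrite (eq_bigr (fun i => enorm v ^+ 2 * u 0 i ^+ 2 + (enorm u ^+ 2 * v 0 i ^+ 2 +
   (- 2 * enorm u * enorm v) * (u 0 i * v 0 i)))); last by move=> i _; ring.
rewrite !big_split/= -!mulr_sumr -!enorm_sqr; ring.
Qed.

Lemma ler_enormD u v : enorm (u + v) <= enorm u + enorm v.
Proof.
rewrite -(@ler_pXn2r _ 2)// ?nnegrE ?addr_ge0 ?enorm_ge0// sqrrD !enorm_sqr.
rewrite (_ : \sum_i (u + v) 0 i ^+ 2 =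
  \sum_i u 0 i ^+ 2 + (\sum_i u 0 i * v 0 i) *+ 2 + \sum_i v 0 i ^+ 2).
  by rewrite lerD2r lerD2l lerMn2r/= cauchy_schwarz.
rewrite -sumrMnl -!big_split/=; apply: eq_bigr => i _.
by rewrite mxE sqrrD.
Qed.

Lemma ler_enorm_distD w u v : enorm (u - v) <= enorm (u - w) + enorm (w - v).
Proof. by rewrite (le_trans _ (ler_enormD _ _))// addrA subrK. Qed.

Lemma ler_enormB u v : enorm (u - v) <= enorm u + enorm v.
Proof. by rewrite (le_trans (ler_enormD _ _))// enormN. Qed.

Lemma norm_le_enorm v : `|v| <= enorm v.
Proof.
rewrite {1}/Num.norm/= mx_normrE; apply/bigmax_leP; split; first exact: enorm_ge0.
by move=> [i j] _ /=; rewrite ord1 coord_le_enorm.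
Qed.

Lemma coord_le_norm v i : `|v 0 i| <= `|v|.
Proof.
rewrite {2}/Num.norm/= mx_normrE.
by apply/bigmax_geP; right => /=; exists (0, i).
Qed.

Lemma enorm_le_norm v : enorm v <= n%:R * `|v|.
Proof.
have le1 (s : seq 'I_n) :
    Num.sqrt (\sum_(i <- s) v 0 i ^+ 2) <= (size s)%:R * `|v|.
  elim: s => [|i s IH]; first by rewrite big_nil sqrtr0 mul0r.
  rewrite big_cons/= -natr1 mulrDl mul1r.
  have s0 : 0 <= \sum_(j <- s) v 0 j ^+ 2.
    by apply: sumr_ge0 => j _; exact: sqr_ge0.
  rewrite -(@ler_pXn2r _ 2)// ?nnegrE ?addr_ge0 ?mulr_ge0 ?sqrtr_ge0//.
  rewrite sqr_sqrtr ?addr_ge0 ?sqr_ge0// sqrrD.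
  have vi : v 0 i ^+ 2 <= `|v| ^+ 2.
    by rewrite -real_normK ?num_real// ler_pXn2r ?nnegrE// coord_le_norm.
  have {}IH : \sum_(j <- s) v 0 j ^+ 2 <= ((size s)%:R * `|v|) ^+ 2.
    by rewrite -[leLHS]sqr_sqrtr// ler_pXn2r ?nnegrE ?sqrtr_ge0 ?mulr_ge0.
  rewrite addrC (le_trans (lerD IH vi))// lerD2r lerDl.
  by rewrite mulrn_wge0// !mulr_ge0.
by have := le1 (enum 'I_n); rewrite size_enum_ord big_enum.
Qed.

Lemma enorm_lip u v : `|enorm u - enorm v| <= enorm (u - v).
Proof.
have := ler_enormD (u - v) v; have := ler_enormD (v - u) u.
by rewrite !subrK (enormBC v) ler_norml; lra.
Qed.

(** The topology of row vectors is defined by the max norm; the two lemmas below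
    let every limit be read in the Euclidean norm instead. *)
Lemma enorm_cvgP (T : Type) (F : set_system T) (z : T -> 'rV[R]_n) v :
  Filter F ->
  (z @ F --> v) <-> (forall e, 0 < e -> \forall t \near F, enorm (z t - v) < e).
Proof.
move=> FF; split=> [/cvgrPdist_lt zv e e0|zv].
  have : 0 < e / (n%:R + 1) by rewrite divr_gt0// ltr_wpDl.
  move=> /zv; apply: filterS => t; rewrite ltr_pdivlMr ?ltr_wpDl// => h.
  rewrite enormBC (le_lt_trans (enorm_le_norm _))// (le_lt_trans _ h)//.
  by rewrite mulrDr mulr1 mulrC lerDl.
apply/cvgrPdist_lt => e /zv; apply: filterS => t.
by rewrite enormBC; exact: le_lt_trans (norm_le_enorm _).
Qed.

Lemma within_enormP (A : set R) (z : R -> 'rV[R]_n) :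
  {within A, continuous z} <->
  (forall s, A s -> forall e, 0 < e -> exists2 d, 0 < d &
     forall t, A t -> `|t - s| < d -> enorm (z t - z s) < e).
Proof.
split=> [/subspace_continuousP zc s As e e0|zc].
  have /enorm_cvgP/(_ _ e0) := zc s As.
  move=> /nbhs_ballP[d /= d0 h]; exists d => // t At ts.
  by apply: h => //; rewrite /ball/= distrC.
apply/subspace_continuousP => s As; apply/enorm_cvgP => e /(zc _ As)[d d0 h].
apply/nbhs_ballP; exists d => //= t; rewrite /ball/= distrC => ts At.
exact: h.
Qed.

End EuclideanNorm.

(** * Growth estimates by induction along a segment *)

Section Growth.
Context {R : realType} {n : nat}.
Implicit Types (z : R -> 'rV[R]_n) (G : R -> R).

(** Take the supremum of the points up to which P holds: the first hypothesis
    makes P hold at the supremum, the second one then pushes beyond it.  Both the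
    mean value inequality and the Gronwall estimate are instances. *)
Lemma real_induction (a b : R) (P : R -> Prop) :
  (forall t, a <= t <= b -> (forall u, a <= u < t -> P u) -> P t) ->
  (forall t, a <= t < b -> P t ->
     exists2 d, 0 < d & forall u, t < u -> u < t + d -> P u) ->
  forall t, a <= t <= b -> P t.
Proof.
move=> Pl Pr t /andP[at_ tb].
have ab := le_trans at_ tb.
pose S := [set t | a <= t <= b /\ forall u, a <= u <= t -> P u].
have Pa : P a by apply: Pl; [rewrite lexx|move=> u /andP[au]; rewrite ltNge au].
have Sa : S a.
  split; first by rewrite lexx.
  by move=> u /andP[au ua]; have -> : u = a by apply/eqP; rewrite eq_le ua.
have Sb : has_ubound S by exists b => u [/andP[_ ub] _].
have hS : has_sup S by split; [exists a|].
set c := sup S.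
have ac : a <= c by apply: ub_le_sup.
have cb : c <= b by apply: ge_sup; [exists a|move=> u [/andP[_ ub] _]].
have Pltc u : a <= u < c -> P u.
  move=> /andP[au uc]; have cu : 0 < c - u by rewrite subr_gt0.
  have [v [_ vP]] := sup_adherent cu hS.
  by rewrite subKr => uv; apply: vP; rewrite au ltW.
have Pc : P c by apply: Pl => //; rewrite ac.
have Plec u : a <= u <= c -> P u.
  move=> /andP[au]; rewrite le_eqVlt => /predU1P[->//|uc].
  by apply: Pltc; rewrite au.
have [bc|cb'] := leP b c; first by apply: Plec; rewrite at_ (le_trans tb).
have /Pr/(_ Pc)[d d0 hd] : a <= c < b by rewrite ac.
pose h := Num.min (d / 2) (b - c).
have h0 : 0 < h by rewrite lt_min divr_gt0//= subr_gt0.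
have hd2 : h < d by rewrite gt_min ltr_pdivrMr// ltr_pMr// ltr1n.
have hb : c + h <= b by rewrite -lerBrDl ge_min lexx orbT.
have /(ub_le_sup Sb) : S (c + h).
  split; first by rewrite hb andbT (le_trans ac)// lerDl ltW.
  move=> u /andP[au uch]; have [uc|cu] := leP u c; first by apply: Plec; rewrite au.
  by apply: hd => //; rewrite (le_lt_trans uch)// ltrD2l.
by rewrite -/c gerDl leNgt h0.
Qed.

Lemma growth_from (a b e : R) z G : a <= b -> 0 < e ->
  {within `[a, b], continuous z} ->
  (forall s t, a <= s -> s <= t -> t <= b -> G s <= G t) ->
  (forall s, a <= s < b -> exists2 d, 0 < d & forall h, 0 < h -> h < d ->
     enorm (z (s + h) - z s) <= G (s + h) - G s + e * h) ->
  enorm (z b - z a) <= G b - G a + e * (b - a).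
Proof.
move=> ab e0 /within_enormP zc Gnd loc.
apply: (real_induction a b (fun t =>
  enorm (z t - z a) <= G t - G a + e * (t - a))); last by rewrite ab lexx.
- move=> t /andP[at_ tb] Pu; have [<-|ant] := eqVneq a t.
    by rewrite !subrr enorm0 mulr0 addr0.
  have {ant}at' : a < t by rewrite lt_neqAle ant.
  apply/ler_addgt0Pr => k k0.
  have tI : `[a, b]%classic t by rewrite /= in_itv/= at_.
  have [d d0 hd] := zc _ tI _ k0.
  (* A point of [a, t[ at distance less than d from t. *)
  pose u := Num.max a (t - d / 2).
  have d2 : 0 < d / 2 by rewrite divr_gt0.
  have ut : u < t by rewrite gt_max at'/= ltrBlDr ltrDl.
  have au : a <= u by rewrite le_max lexx.
  have tu : t - d / 2 <= u by rewrite le_max lexx orbT.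
  have Pu' := Pu u; rewrite au ut in Pu'; have {Pu'}Pu' := Pu' isT.
  have h1 : enorm (z t - z u) < k.
    rewrite enormBC hd//= ?in_itv/= ?au/= ?(le_trans (ltW ut))//.
    by rewrite ltr0_norm ?subr_lt0// opprB; lra.
  have h2 := Gnd _ _ au (ltW ut) tb.
  have h3 : e * (u - a) <= e * (t - a) by rewrite ler_pM2l// lerB// ltW.
  by rewrite (le_trans (ler_enorm_distD (z u) _ _))//; lra.
- move=> t /loc[d d0 hd] Pt; exists d => // u tu ud.
  have ut0 : 0 < u - t by rewrite subr_gt0.
  have utd : u - t < d by rewrite ltrBlDl.
  have := hd _ ut0 utd; rewrite subrKC => H.
  by rewrite (le_trans (ler_enorm_distD (z t) _ _))//; lra.
Qed.

(** A mean value inequality in terms of right increments: local errors e * h add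
    up to e * (b - a), and e is arbitrary.  G is only nondecreasing, so that it
    may contain a variation function of unknown regularity; and the local
    hypothesis is restricted to the open interval, by continuity of z at a. *)
Lemma growth (a b : R) z G : a <= b ->
  {within `[a, b], continuous z} ->
  (forall s t, a <= s -> s <= t -> t <= b -> G s <= G t) ->
  (forall s e, a < s < b -> 0 < e -> exists2 d, 0 < d &
     forall h, 0 < h -> h < d ->
     enorm (z (s + h) - z s) <= G (s + h) - G s + e * h) ->
  enorm (z b - z a) <= G b - G a.
Proof.
move=> ab zc Gnd loc.
have [->|anb] := eqVneq a b; first by rewrite !subrr enorm0.
have {anb}ab' : a < b by rewrite lt_neqAle anb.
apply/ler_addgt0Pr => k k0.
have /within_enormP zc' := zc.
have aI : `[a, b]%classic a by rewrite /= in_itv/= lexx.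
have k2 : 0 < k / 2 by rewrite divr_gt0.
have [d d0 hd] := zc' _ aI _ k2.
(* Start at c slightly to the right of a, giving up k / 2 for the step from a
   to c and k / 2 for the accumulated errors. *)
pose c := a + Num.min (d / 2) (b - a).
have m0 : 0 < Num.min (d / 2) (b - a) by rewrite lt_min divr_gt0//= subr_gt0.
have ac : a < c by rewrite ltrDl.
have cb : c <= b by rewrite -lerBrDl ge_min lexx orbT.
have cd : c - a < d.
  by rewrite /c addrAC subrr add0r gt_min ltr_pdivrMr// ltr_pMr// ltr1n.
have e0 : 0 < k / 2 / (b - a) by rewrite divr_gt0// subr_gt0.
have h1 : enorm (z b - z c) <= G b - G c + k / 2 / (b - a) * (b - c).
  apply: growth_from => //.
  - apply: continuous_subspaceW zc; apply: subset_itvr => /=.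
    by rewrite bnd_simp ltW.
  - by move=> s t cs; apply: Gnd; rewrite (le_trans _ cs)// ltW.
  - by move=> s /andP[cs sb]; apply: loc => //; rewrite sb (lt_le_trans ac).
have h2 : k / 2 / (b - a) * (b - c) <= k / 2.
  rewrite mulrAC ler_pdivrMr ?subr_gt0// ler_pM2l// lerB// ltW//.
have h3 : enorm (z c - z a) < k / 2.
  by rewrite hd//= ?in_itv/= ?(ltW ac)// gtr0_norm ?subr_gt0.
have h4 := Gnd a c (lexx a) (ltW ac) cb.
by rewrite (le_trans (ler_enorm_distD (z c) _ _))//; lra.
Qed.

End Growth.

(** * Sup, Hoelder and derivative estimates *)

Section Norms.
Context {R : realType} {n : nat}.
Implicit Types (x y : R -> 'rV[R]_n) (r a A : R).

Lemma supnormP r x A :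
  (supnorm r x <= A%:E)%E <-> (forall s, - r <= s <= 0 -> enorm (x s) <= A).
Proof.
split=> [/ereal_supP xA s sr|xA].
  by rewrite -lee_fin; apply: xA; exists s => //=; rewrite in_itv.
apply/ereal_supP => _ [s /= + <-]; rewrite in_itv/= => sr.
by rewrite lee_fin xA.
Qed.

Lemma supnorm_ge0 r x : 0 <= r -> (0 <= supnorm r x)%E.
Proof.
move=> r0; apply: ereal_sup_ge; exists (enorm (x 0))%:E.
  by exists 0 => //=; rewrite in_itv/= lexx oppr_le0 r0.
by rewrite lee_fin enorm_ge0.
Qed.

Lemma holder_seminormP r a x A : 0 < a -> 0 <= A ->
  (holder_seminorm r a x <= A%:E)%E <->
  (forall s t, - r <= s <= 0 -> - r <= t <= 0 ->
     enorm (x s - x t) <= A * `|s - t| `^ a).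
Proof.
move=> a0 A0; split=> [/ereal_supP xA s t sr tr|xA].
  have [->|st] := eqVneq s t.
    by rewrite !subrr enorm0 mulr_ge0// powR_ge0.
  rewrite -ler_pdivrMr ?powR_gt0 ?normr_gt0 ?subr_eq0//.
  by rewrite -lee_fin; apply: xA; exists (s, t) => //=; rewrite !in_itv.
apply/ereal_supP => y0 [[s t] /=]; rewrite !in_itv/= => -[sr tr st] <-.
by rewrite lee_fin ler_pdivrMr ?powR_gt0 ?normr_gt0 ?subr_eq0// xA.
Qed.

Lemma C0P r x : C0 r x <->
  (forall s, - r <= s <= 0 -> forall e, 0 < e -> exists2 d, 0 < d &
     forall t, - r <= t <= 0 -> `|t - s| < d -> enorm (x t - x s) < e).
Proof.
split=> [/within_enormP xc s sr e e0|xc].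
  have [|d d0 h] := xc s _ e e0; first by rewrite /= in_itv.
  by exists d => // t tr; apply: h; rewrite /= in_itv.
apply/within_enormP => s /=; rewrite in_itv/= => sr e /(xc _ sr)[d d0 h].
by exists d => // t; rewrite in_itv/=; exact: h.
Qed.

Lemma within_bounded (a b : R) x : {within `[a, b], continuous x} ->
  exists2 M, 0 <= M & forall s, a <= s <= b -> enorm (x s) <= M.
Proof.
move=> /within_enormP xc; have [ab|ba] := leP a b; last first.
  by exists 0 => // s /andP[as_ sb]; have := le_trans as_ sb; lra.
have ec : {within `[a, b], continuous (fun s => enorm (x s))}.
  apply/subspace_continuousP => s sab; apply/cvgrPdist_lt => e e0.
  have [d d0 hd] := xc s sab e e0.
  apply/nbhs_ballP; exists d => //= t; rewrite /ball/= distrC => ts tab.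
  by rewrite (le_lt_trans (enorm_lip _ _))// enormBC; exact: hd.
have [c _ cmax] := EVT_max ab ec.
exists (enorm (x c)); first exact: enorm_ge0.
by move=> s sab; apply: cmax; rewrite in_itv.
Qed.

Lemma derivable_right_estimate (V : normedModType R) (z : R -> V) s e :
  derivable z s 1 -> 0 < e ->
  exists2 d, 0 < d & forall h, 0 < h -> h < d ->
    `|z (s + h) - z s - h *: derive1 z s| <= e * h.
Proof.
move=> dz e0.
have zs : (h^-1 *: (z (h + s) - z s)) @[h --> 0^'] --> derive1 z s.
  move: dz; rewrite /derivable /derive1.
  have -> // : (fun h : R => h^-1 *: ((z \o shift s) (h *: (1:R)) - z s)) =
      (fun h => h^-1 *: (z (h + s) - z s)).
  by apply/funext => h /=; rewrite [h *: (1:R)]mulr1.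
move/cvgrPdist_le/(_ _ e0) : zs.
move=> [d /= d0 hd]; exists d => // h h0 hhd.
have := hd h; rewrite /ball_/= sub0r normrN gtr0_norm// => /(_ hhd (lt0r_neq0 h0)).
rewrite distrC (addrC s h) => H.
have -> : z (h + s) - z s - h *: derive1 z s = h *: (h^-1 *: (z (h + s) - z s) - derive1 z s).
  by rewrite scalerBr scalerA divff ?gt_eqF// scale1r.
by rewrite normrZ gtr0_norm// mulrC ler_pM2r.
Qed.

Lemma derivable_right_enorm x s e : derivable x s 1 -> 0 < e ->
  exists2 d, 0 < d & forall h, 0 < h -> h < d ->
    enorm (x (s + h) - x s - h *: derive1 x s) <= e * h.
Proof.
move=> dx e0.
have e1 : 0 < e / (n%:R + 1) by rewrite divr_gt0// ltr_wpDl.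
have [d d0 hd] := derivable_right_estimate _ _ s _ dx e1.
exists d => // h h0 /(hd _ h0) hh.
rewrite (le_trans (enorm_le_norm _))//.
rewrite (le_trans (ler_wpM2l _ hh))// mulrA mulrCA.
rewrite -[X in _ <= X * _]mulr1 ler_pM2r// ler_pM2l//.
by rewrite ler_pdivrMr ?ltr_wpDl// mul1r lerDl.
Qed.

Lemma derivable_growth_step x (G : R -> R) s e :
  derivable x s 1 -> derivable G s 1 -> enorm (derive1 x s) <= derive1 G s ->
  0 < e -> exists2 d, 0 < d & forall h, 0 < h -> h < d ->
    enorm (x (s + h) - x s) <= G (s + h) - G s + e * h.
Proof.
move=> dx dG le e0; have e2 : 0 < e / 2 by rewrite divr_gt0.
have [d1 d10 h1] := derivable_right_enorm _ _ _ dx e2.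
have [d2 d20 h2] := derivable_right_estimate _ _ _ _ dG e2.
exists (Num.min d1 d2); first by rewrite lt_min d10.
move=> h h0; rewrite lt_min => /andP[/(h1 _ h0) + /(h2 _ h0)].
rewrite ler_norml => H1 /andP[H2 _].
have : enorm (x (s + h) - x s) <= e / 2 * h + h * derive1 G s.
  rewrite -[_ - x s](subrK (h *: derive1 x s)) (le_trans (ler_enormD _ _))//.
  by rewrite lerD// enormZ gtr0_norm// ler_pM2l.
by move: H2; rewrite /GRing.scale/=; lra.
Qed.

Lemma growth_derivable (a b : R) x (G : R -> R) : a <= b ->
  {within `[a, b], continuous x} ->
  (forall s t, a <= s -> s <= t -> t <= b -> G s <= G t) ->
  (forall s, a < s < b -> [/\ derivable x s 1, derivable G s 1 &
     enorm (derive1 x s) <= derive1 G s]) ->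
  enorm (x b - x a) <= G b - G a.
Proof.
move=> ab xc Gnd dxG; apply: growth => // s e /dxG[dx dG le].
exact: derivable_growth_step.
Qed.

Lemma is_derive_mull (M s : R) : is_derive s (1:R) (fun t : R => M * t) M.
Proof.
rewrite -[X in is_derive _ _ _ X]mulr1.
exact: (@is_deriveZ _ _ _ (@id R) M s 1 1).
Qed.

Lemma lipschitz_of_derive (a b M : R) x : a <= b ->
  {within `[a, b], continuous x} ->
  (forall s, a < s < b -> derivable x s 1 /\ enorm (derive1 x s) <= M) ->
  enorm (x b - x a) <= M * (b - a).
Proof.
move=> ab xc dx.
have [eab|ab'] := eqVneq a b.
  by rewrite eab !subrr enorm0 mulr0.
have {ab'} ab1 : a < b by rewrite lt_neqAle ab'.
have M0 : 0 <= M.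
  have m : a < (a + b) / 2 < b by rewrite midf_lt//= midf_lt.
  by have [_] := dx _ m; apply: le_trans; exact: enorm_ge0.
have -> : M * (b - a) = M * b - M * a by rewrite mulrBr.
apply: (growth_derivable _ _ _ (fun t => M * t)) => //.
  by move=> s t _ st _; rewrite ler_wpM2l.
move=> s /dx[H0 le].
have [dM1 dM2] := is_derive_mull M s; split; [exact: H0|exact: dM1|].
by rewrite (derive1E (fun t => M * t)) dM2.
Qed.

End Norms.

(** * Absolutely continuous curves *)

Section AbsoluteContinuity.
Context {R : realType} {n : nat}.
Implicit Types (x : R -> 'rV[R]_n) (r : R).
Local Notation mu := (@lebesgue_measure R).

Lemma sum_lengths_lt (k : nat) (u v : 'I_k -> R) (U : set R) (d : R) :
  (forall i, u i <= v i) ->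
  trivIset setT (fun i => `]u i, v i[%classic) ->
  (forall i, `]u i, v i[ `<=` U) -> measurable U -> (mu U < d%:E)%E ->
  \sum_i (v i - u i) < d.
Proof.
move=> uv tuv uvU mU; rewrite -lte_fin; apply: le_lt_trans.
rewrite -sumEFin (eq_bigr (fun i => mu `]u i, v i[%classic)); last first.
  move=> i _; rewrite lebesgue_measure_itv/= lte_fin lt_neqAle uv andbT.
  by case: eqVneq => //= ->; rewrite subrr.
rewrite -(@measure_bigsetU_ord _ _ _ mu k xpredT)//.
apply: le_measure; rewrite ?inE//.
  by apply: bigsetU_measurable => i _.
by rewrite -bigcup_seq => y [i _] /uvU.
Qed.

(** The supremum of these sums is the variation of x over the part of U that
    lies before t. *)
Definition variation_sums r x (U : set R) (t : R) : set R :=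
  [set S | exists k (u v : 'I_k -> R),
    [/\ forall i, [/\ - r <= u i, u i <= v i & v i <= t],
        trivIset setT (fun i => `]u i, v i[%classic),
        forall i, `]u i, v i[ `<=` U
      & S = \sum_i enorm (x (v i) - x (u i))]].

Lemma variation_sums0 r x U t : variation_sums r x U t 0.
Proof.
exists 0%N, (fun=> 0), (fun=> 0); split => //; [by case|by move=> [] |by case|].
by rewrite big_ord0.
Qed.

(** An interval ]s, t[ can be appended because all the intervals of the family
    end before s; hence the supremum of the sums grows at least like the
    increments of x inside U. *)
Lemma variation_sums_extend r x U s t S : - r <= s -> s <= t ->
  `]s, t[ `<=` U -> variation_sums r x U s S ->
  variation_sums r x U t (S + enorm (x t - x s)).
Proof.
move=> rs st stU [k [u [v [uv tuv uvU ->]]]].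
exists k.+1, (fun i => if unlift ord_max i is Some j then u j else s),
  (fun i => if unlift ord_max i is Some j then v j else t); split.
- move=> i; case: unliftP => [j _|_]; last by split.
  by have [? ? vs] := uv j; split => //; exact: le_trans vs st.
- move=> i j _ _.
  case: unliftP => [i' ->|->]; case: unliftP => [j' ->|->] //.
  + by move=> /(tuv _ _ I I) ->.
  + move=> [y [/=]]; rewrite !in_itv/= => /andP[_ yv] /andP[sy _].
    have [_ _ vs] := uv i'.
    by have := lt_trans (lt_le_trans yv vs) sy; rewrite ltxx.
  + move=> [y [/=]]; rewrite !in_itv/= => /andP[sy _] /andP[_ yv].
    have [_ _ vs] := uv j'.
    by have := lt_trans (lt_le_trans yv vs) sy; rewrite ltxx.
- by move=> i; case: unliftP => [j _|_].
- rewrite big_ord_recr/= unlift_none; congr (_ + _).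
  apply: eq_bigr => i _.
  have -> : widen_ord (leqnSn k) i = lift ord_max i.
    by apply: val_inj => /=; rewrite /bump leqNgt ltn_ord.
  by rewrite liftK.
Qed.

Lemma abs_continuous_C0 r x : abs_continuous r x -> C0 r x.
Proof.
move=> acx; apply/C0P => s sr e /acx[d d0 hd]; exists d => // t tr ts.
wlog st : s t sr tr ts / s <= t.
  move=> H; have [|/ltW] := leP s t; first exact: H.
  by rewrite enormBC; apply: H => //; rewrite distrC.
have := hd 1%N (fun=> s) (fun=> t); rewrite !big_ord1; apply.
- by move: sr tr => /andP[? ?] /andP[].
- by move=> i j _ _ _; rewrite !ord1.
- by move: ts; rewrite ger0_norm ?subr_ge0.
Qed.

(** Cover the exceptional null set by an open set U so small that absolute
    continuity bounds by k the variation V of x over the intervals of U.  Inside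
    U the increments of x are bounded by those of V, outside U by those of G up
    to e * h; so [growth] applies to G + V, and V contributes at most k. *)
Lemma abs_continuous_growth r x (G : R -> R) a b :
  abs_continuous r x -> - r <= a -> a <= b -> b <= 0 ->
  (forall s t, a <= s -> s <= t -> t <= b -> G s <= G t) ->
  {ae mu, forall s, a < s < b -> [/\ derivable x s 1, derivable G s 1 &
     enorm (derive1 x s) <= derive1 G s]} ->
  enorm (x b - x a) <= G b - G a.
Proof.
move=> acx ra ab b0 Gnd aeH.
have [N [mN N0 aeN]] : exists N : set R, [/\ measurable N, mu N = 0%E &
  ~` [set s | a < s < b -> [/\ derivable x s 1, derivable G s 1 &
     enorm (derive1 x s) <= derive1 G s]] `<=` N] by exact: aeH.
apply/ler_addgt0Pr => k k0.
have [d d0 hd] := acx _ k0.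
have [|U [oU NU muU]] := @lebesgue_regularity_outer R N d mN _ d0.
  by suff : (mu N < +oo)%E by []; rewrite N0 ltry.
have mU : measurable U by exact: open_measurable.
have UN0 : mu (U `&` N) = 0%E.
  by apply: (@subset_measure0 _ _ _ mu _ N) => //; exact: measurableI.
have {}muU : (mu U < d%:E)%E.
  have UE : mu U = (mu (U `\` N) + mu (U `&` N))%E by exact: measureDI.
  by rewrite UE UN0 adde0.
have Vub t : t <= b -> ubound (variation_sums r x U t) k.
  move=> tb _ [m [u [v [uv tuv uvU ->]]]]; apply/ltW/hd => //.
    by move=> i; have [? ? ?] := uv i; split => //; rewrite (le_trans _ b0)// (le_trans _ tb).
  by apply: (sum_lengths_lt _ _ _ U) => // i; have [] := uv i.
have Vsup t : t <= b -> has_sup (variation_sums r x U t).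
  by move=> tb; split; [exists 0; exact: variation_sums0|exists k; exact: Vub].
pose V t := sup (variation_sums r x U t).
have V0 t : t <= b -> 0 <= V t.
  by move=> tb; apply: ub_le_sup; [exists k; exact: Vub|exact: variation_sums0].
have Vk t : t <= b -> V t <= k.
  by move=> tb; apply: ge_sup; [exists 0; exact: variation_sums0|exact: Vub].
have Vstep s t : - r <= s -> s <= t -> t <= b -> `]s, t[ `<=` U ->
    enorm (x t - x s) <= V t - V s.
  move=> rs st tb stU; rewrite lerBrDl -lerBrDr.
  apply: ge_sup; first by exists 0; exact: variation_sums0.
  move=> S VS; rewrite lerBrDr; apply: ub_le_sup; first by exists k; exact: Vub.
  exact: variation_sums_extend.
have Vnd s t : s <= t -> t <= b -> V s <= V t.
  move=> st tb; apply: ge_sup; first by exists 0; exact: variation_sums0.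
  move=> S [m [u [v [uv tuv uvU SE]]]]; apply: ub_le_sup; first by exists k; exact: Vub.
  exists m, u, v; split => // i; have [? ? vs] := uv i; split => //.
  exact: le_trans vs st.
suff H : enorm (x b - x a) <= (G b + V b) - (G a + V a).
  by have := Vk b (lexx b); have := V0 a ab; lra.
apply: (growth _ _ _ (fun t => G t + V t)) => //.
- apply: continuous_subspaceW (abs_continuous_C0 _ _ acx).
  by move=> s /=; rewrite !in_itv/= => /andP[sa sb]; rewrite (le_trans ra sa) (le_trans sb b0).
- by move=> s t sa st tb; rewrite lerD ?Gnd ?Vnd.
move=> s e /andP[sa sb] e0.
have [Us|NUs] := pselect (U s).
  have /nbhs_ballP[d1 /= d10 hU] : nbhs s U by apply: open_nbhs_nbhs.
  exists (Num.min d1 (b - s)); first by rewrite lt_min d10 subr_gt0.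
  move=> h h0; rewrite lt_min => /andP[hd1 hb].
  have shb : s + h <= b by lra.
  have ssh : s <= s + h by lra.
  have : enorm (x (s + h) - x s) <= V (s + h) - V s.
    apply: Vstep => //; first lra.
    move=> y /=; rewrite in_itv/= => /andP[sy yh]; apply: hU.
    by rewrite /ball/= ltr0_norm ?subr_lt0//; lra.
  have := Gnd s (s + h) (ltW sa) ssh shb.
  have : 0 <= e * h by rewrite mulr_ge0// ltW.
  lra.
have [dx dG le] : [/\ derivable x s 1, derivable G s 1 &
     enorm (derive1 x s) <= derive1 G s].
  apply: contrapT => nP; apply: NUs; apply: NU; apply: aeN => /= P.
  by apply: nP; apply: P; rewrite sa.
have [d1 d10 h1] := derivable_growth_step _ _ _ _ dx dG le e0.
exists (Num.min d1 (b - s)); first by rewrite lt_min d10 subr_gt0.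
move=> h h0; rewrite lt_min => /andP[/(h1 _ h0) H hb].
have : V s <= V (s + h) by apply: Vnd; lra.
by lra.
Qed.

End AbsoluteContinuity.

(** * Embedding of the Sobolev space in a Hoelder space *)

Lemma holder_exponent_gt0 (R : realType) (p : \bar R) :
  (1 < p)%E -> 0 < holder_exponent p.
Proof.
case: p => //= q; rewrite lte_fin => q1.
by rewrite subr_gt0 invf_lt1// (lt_trans ltr01).
Qed.

Lemma holder_exponent_le1 (R : realType) (p : \bar R) :
  (1 < p)%E -> holder_exponent p <= 1.
Proof.
case: p => //= q; rewrite lte_fin => q1.
by rewrite gerBl invr_ge0 ltW// (lt_trans ltr01).
Qed.

Section Integral.
Context {R : realType}.
Implicit Types (g : R -> R) (a b : R).
Local Notation mu := (@lebesgue_measure R).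

(** Hoelder's inequality against the indicator function of ]a, b]. *)
Lemma integral_le_Lnorm (p : \bar R) g a b : (1 < p)%E -> a < b ->
  measurable_fun setT g -> (forall t, 0 <= g t) ->
  (\int[mu]_(t in `]a, b]) (g t)%:E <=
   Lnorm mu p (EFin \o g) * ((b - a) `^ holder_exponent p)%:E)%E.
Proof.
move=> + ab mg g0.
have muab : mu `]a, b]%classic = (b - a)%:E.
  by rewrite lebesgue_measure_itv/= lte_fin ab.
case: p => //= [q|_].
- rewrite lte_fin => q1.
  have q0 : 0 < q by rewrite (lt_trans ltr01).
  have c0 : 0 < 1 - q^-1 by rewrite subr_gt0 invf_lt1.
  have := @hoelder _ _ R mu g (\1_`]a, b]%classic) q (1 - q^-1)^-1 mg.
  rewrite invrK subrKC invr_gt0 => /(_ _ q0 c0 erefl) H.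
  have mi : measurable_fun setT (\1_`]a, b]%classic : R -> R).
    by apply: measurable_indic; exact: measurable_itv.
  have {H} := H mi.
  rewrite Lnorm1.
  have -> : (\int[mu]_x `|(EFin \o (g \* \1_(`]a, b]%classic))%R) x| =
      \int[mu]_(t in `]a, b]) (g t)%:E)%E.
    rewrite [RHS]integral_mkcond; apply: eq_integral => t _ /=.
    rewrite patchE indicE ger0_norm ?mulr_ge0//.
    by case: ifPn => _; rewrite ?mulr1 ?mulr0.
  move=> /le_trans; apply; rewrite lee_pmul// ?Lnorm_ge0//.
  rewrite unlock/= invrK.
  have -> : (\int[mu]_x (`|(\1_(`]a, b]%classic) x : R)%:E| `^ (1 - q^-1)^-1) = (b - a)%:E)%E.
    rewrite -muab -[RHS]mul1e -integral_cst// [RHS]integral_mkcond.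
    apply: eq_integral => t _ /=.
    rewrite patchE indicE; case: ifPn => _.
      by rewrite normr1 powR1.
    by rewrite normr0 powR0// invr_eq0 gt_eqF.
  by rewrite poweR_EFin.
- rewrite powRr1 ?subr_ge0 ?(ltW ab)// unlock/=.
  have muT : (0 < mu setT)%E.
    apply: (@lt_le_trans _ _ (mu `]a, b]%classic)); last by rewrite le_measure ?inE.
    by rewrite muab lte_fin subr_gt0.
  rewrite muT -muab.
  set C := ess_sup _ _.
  have C0 : (0 <= C)%E by apply: ess_sup_gee => //; apply: nearW => t /=; rewrite lee_fin.
  apply: (@le_trans _ _ (\int[mu]_(t in `]a, b]) C)%E); last first.
    by rewrite integral_cst.
  apply: ae_ge0_le_integral => //.
  + by move=> t _; rewrite lee_fin.
  + by apply/measurable_EFinP; exact: measurable_funS mg.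
  + have := @ess_sup_ge _ _ _ mu (abse \o (EFin \o g)).
    apply: filterS => t /= + _; apply: le_trans.
    by rewrite lee_fin ler_norm.
Qed.

End Integral.

Section SobolevEmbedding.
Context {R : realType} {n : nat}.
Implicit Types (x z : R -> 'rV[R]_n) (r : R).
Local Notation mu := (@lebesgue_measure R).

Lemma measurable_enorm (D : set R) z : measurable D ->
  (forall i, measurable_fun D (fun s => z s 0 i)) ->
  measurable_fun D (fun s => enorm (z s)).
Proof.
move=> mD mz; rewrite /enorm.
have ms : measurable_fun setT (@Num.sqrt R).
  by apply: continuous_measurable_fun; exact: sqrt_continuous.
apply: (measurableT_comp ms).
by apply: measurable_sum => i; exact: measurable_funX.
Qed.

(** The norm of the derivative, extended by 0 to the real line so that its
    primitive and its norms are taken over the whole line. *)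
Definition speed r x : R -> R := (fun s => enorm (derive1 x s)) \_ `]- r, 0[.

Lemma speed_ge0 r x t : 0 <= speed r x t.
Proof. by rewrite /speed patchE; case: ifPn => // _; exact: enorm_ge0. Qed.

Lemma deriv_LnormE r p x :
  deriv_Lnorm r p x = Lnorm mu p (EFin \o speed r x).
Proof.
apply: eq_Lnorm => t; rewrite /speed /= !patchE.
by case: ifPn.
Qed.

Lemma measurable_speed r x :
  (forall i, measurable_fun `]- r, 0[ (fun s => derive1 x s 0 i)) ->
  measurable_fun setT (speed r x).
Proof.
move=> mx; apply/(measurable_restrictT _ _).1 => //.
exact: measurable_enorm.
Qed.

(** By Lebesgue's differentiation theorem the primitive F of the speed has the
    speed as derivative almost everywhere, so the increments of the absolutely
    continuous x are bounded by those of F; Hoelder's inequality concludes. *)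
Lemma sobolev_holder_ball r p x A : 0 < r -> (1 < p)%E ->
  carrier (sobolev r p) x -> (space_norm (sobolev r p) x <= A%:E)%E ->
  (forall s, - r <= s <= 0 -> enorm (x s) <= A) /\
  (forall s t, - r <= s <= 0 -> - r <= t <= 0 ->
     enorm (x s - x t) <= A * `|s - t| `^ holder_exponent p).
Proof.
move=> r0 p1 [acx [dx mdx dxoo]] /= xA.
have dx0 : (0 <= deriv_Lnorm r p x)%E by exact: Lnorm_ge0.
have sx0 : (0 <= supnorm r x)%E by apply: supnorm_ge0; exact: ltW.
split.
  by apply/supnormP; rewrite (le_trans _ xA)// leeDl.
have dxA : (deriv_Lnorm r p x <= A%:E)%E by rewrite (le_trans _ xA)// leeDr.
have mg : measurable_fun setT (speed r x) by exact: measurable_speed.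
have ig : mu.-integrable setT (EFin \o speed r x).
  apply/integrableP; split; first exact/measurable_EFinP.
  apply: (@le_lt_trans _ _ (\int[mu]_t (speed r x t)%:E)%E).
    rewrite le_eqVlt; apply/orP; left; apply/eqP; apply: eq_integral => t _ /=.
    by rewrite ger0_norm// speed_ge0.
  have -> : (\int[mu]_t (speed r x t)%:E = \int[mu]_(t in `](- r)%R, 0%R]) (speed r x t)%:E)%E.
    rewrite [RHS]integral_mkcond; apply: eq_integral => t _.
    rewrite patchE; case: ifPn => // tr; rewrite /speed patchE ifN//.
    apply: contra tr; rewrite !inE/= !in_itv/= => /andP[-> /ltW//].
  apply: le_lt_trans (integral_le_Lnorm _ _ _ _ p1 _ mg (speed_ge0 r x)) _.
    by rewrite oppr_lt0.
  rewrite -deriv_LnormE (le_lt_trans (lee_pmul _ _ dxA (lexx _)))//.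
    by rewrite lee_fin powR_ge0.
  by rewrite -EFinM ltry.
have igD (D : set R) : measurable D -> mu.-integrable D (EFin \o speed r x).
  by move=> mD; exact: integrableS ig.
pose F t := \int[mu]_(u in `]-oo, t]) speed r x u.
have FB s t : s <= t -> F t - F s = \int[mu]_(u in `]s, t]) speed r x u.
  by move=> st; rewrite /F Rintegral_itvB//; exact: igD.
have dF := FTC1Ny (fun y => igD _ (measurable_itv `]-oo, y]))
  (open_integrable_locally openT ig).
suff H s t : s < t -> - r <= s <= 0 -> - r <= t <= 0 ->
     enorm (x t - x s) <= A * (t - s) `^ holder_exponent p.
  move=> s t sr tr; have [st|ts|->] := ltgtP s t.
  - by rewrite enormBC ltr0_norm ?subr_lt0// opprB H.
  - by rewrite gtr0_norm ?subr_gt0// H.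
  - by rewrite !subrr enorm0 normr0 powR0 ?mulr0// gt_eqF// holder_exponent_gt0.
move=> st /andP[rs s0] /andP[rt t0].
apply: (@le_trans _ _ (F t - F s)).
  apply: (abs_continuous_growth r x F) => //; first exact: ltW.
    move=> u v su uv vt; rewrite -subr_ge0 FB//.
    by apply: Rintegral_ge0 => // w _; exact: speed_ge0.
  apply: filterS2 dx dF; first exact: (ae_filter_ringOfSetsType mu).
  move=> u dxu [dFu Fu] /andP[su ut].
  have ur : u \in `]- r, 0[ by rewrite in_itv/= (le_lt_trans rs)//= (lt_le_trans ut).
  split; [exact: dxu|exact: dFu|].
  by rewrite [leRHS]Fu /speed patchE mem_set.
rewrite FB ?(ltW st)// -lee_fin fineK; last first.
  by apply: integrable_fin_num => //; exact: igD.
apply: le_trans (integral_le_Lnorm _ _ _ _ p1 st mg (speed_ge0 r x)) _.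
by rewrite -deriv_LnormE EFinM lee_pmul2r ?lte_fin ?powR_gt0 ?subr_gt0.
Qed.

End SobolevEmbedding.

(** * Lebesgue norms and translations *)

Section LnormTools.
Context {R : realType}.
Implicit Types (f g : R -> R) (p : \bar R).
Local Notation mu := (@lebesgue_measure R).

Lemma measurable_abs_powR f (q : R) : measurable_fun setT f ->
  measurable_fun setT (fun t => (`|f t| `^ q)%:E).
Proof.
move=> mf; apply/measurable_EFinP; apply: (measurableT_comp (measurable_powR _)).
exact: measurableT_comp.
Qed.

Lemma Lnorm_le_ae p f g : (1 < p)%E ->
  measurable_fun setT f -> measurable_fun setT g ->
  (forall t, 0 <= f t) -> {ae mu, forall t, f t <= g t} ->
  (Lnorm mu p (EFin \o f) <= Lnorm mu p (EFin \o g))%E.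
Proof.
move=> + mf mg f0 fg; rewrite unlock; case: p => //= [q|_].
- rewrite lte_fin => q1; have q0 : 0 < q by exact: lt_trans q1.
  have i0 (h : R -> R) : (0 <= \int[mu]_t (`|h t| `^ q)%:E)%E.
    by apply: integral_ge0 => t _; rewrite lee_fin powR_ge0.
  apply: gt0_ler_poweR; rewrite ?invr_ge0 ?(ltW q0)// ?in_itv/= ?leey ?andbT//.
  apply: ae_ge0_le_integral => //.
  + exact: measurable_abs_powR.
  + exact: measurable_abs_powR.
  + apply: filterS fg; first exact: (ae_filter_ringOfSetsType mu).
    move=> t ft _; rewrite lee_fin ge0_ler_powR ?nnegrE ?(ltW q0)//.
    by rewrite !ger0_norm// (le_trans _ ft).
- case: ifPn => // mu0; apply: le_ess_sup.
  apply: filterS fg; first exact: (ae_filter_ringOfSetsType mu).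
  move=> t /= ft; rewrite lee_fin !ger0_norm//.
  exact: le_trans ft.
Qed.

(** The type of the domain is the one that carries the Borel sigma-algebra on
    which Lebesgue measure is defined. *)
Definition translation (c : R) : measurableTypeR R -> measurableTypeR R :=
  fun s => c + s.

Lemma measurable_translation c : measurable_fun setT (translation c).
Proof. exact: (measurable_funD (measurable_cst c) (@measurable_id _ _ setT)). Qed.

HB.instance Definition _ c := isMeasurableFun.Build _ _ _ _ (translation c)
  (measurable_translation c).

(** Both measures agree on the half-open intervals, which determine Lebesgue
    measure. *)
Lemma lebesgue_measure_translation c (A : set R) : measurable A ->
  pushforward mu (translation c) A = mu A.
Proof.
move=> mA; apply/esym/lebesgue_measure_unique  => //= _ [[a b]] _ <-.
rewrite /pushforward.
have -> : translation c @^-1` `]a, b]%classic = `]a - c, b - c]%classic.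
  apply/seteqP; split => s /=; rewrite !in_itv/= /translation => /andP[? ?];
    apply/andP; split; lra.
rewrite !lebesgue_measure_itv/= !lte_fin ltrD2r; case: ifP => // _.
by rewrite -!EFinD; congr EFin; ring.
Qed.

Lemma Lnorm_translation p c f : (1 < p)%E ->
  measurable_fun setT f -> (forall t, 0 <= f t) ->
  (Lnorm mu p (EFin \o (f \o translation c)) <= Lnorm mu p (EFin \o f))%E.
Proof.
move=> + mf f0; rewrite unlock; case: p => //= [q|_].
- rewrite lte_fin => q1.
  rewrite le_eqVlt; apply/orP; left; apply/eqP; congr (poweR _ _).
  transitivity (\int[pushforward mu (translation c)]_t (`|f t| `^ q)%:E)%E.
    rewrite ge0_integral_pushforward//.
    exact: measurable_abs_powR.
  by apply: eq_measure_integral => A mA _; exact: lebesgue_measure_translation.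
- case: ifPn => // mu0; apply/ess_supP.
  have [N [mN N0 aeN]] : exists N : set R, [/\ measurable N, mu N = 0%E &
     ~` [set t | ((`|f t|%:E : \bar R) <= ess_sup mu (abse \o (EFin \o f)))%E] `<=` N].
    exact: (ess_sup_ge mu (abse \o (EFin \o f))).
  exists (translation c @^-1` N); split.
  + by rewrite -[X in measurable X]setTI; exact: measurable_translation.
  + by apply: etrans N0; exact: (lebesgue_measure_translation c N mN).
  + by move=> t nt; apply: aeN.
Qed.

(** The exponent is 1/p, in the form that also covers p = +oo. *)
Lemma Lnorm_cst_indic p (a b M : R) : (1 < p)%E -> a < b -> 0 <= M ->
  (Lnorm mu p (EFin \o (fun t => M * \1_`]a, b[%classic t)%R) <=
   (M * (b - a) `^ (1 - holder_exponent p))%:E)%E.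
Proof.
move=> + ab M0; rewrite unlock; case: p => //= [q|_].
- rewrite lte_fin => q1; have q0 : 0 < q by exact: lt_trans q1.
  rewrite subKr.
  have -> : (\int[mu]_x (`|M * \1_(`]a, b[%classic) x| `^ q)%:E =
      (M `^ q * (b - a))%:E)%E.
    have -> : (M `^ q * (b - a))%:E = ((M `^ q)%:E * mu `]a, b[%classic)%E.
      by rewrite lebesgue_measure_itv/= lte_fin ab EFinM.
    rewrite -integral_cst// [RHS]integral_mkcond.
    apply: eq_integral => t _ /=; rewrite patchE indicE; case: ifPn => _.
      by rewrite mulr1 ger0_norm.
    by rewrite mulr0 normr0 powR0// gt_eqF.
  rewrite poweR_EFin lee_fin powRM ?powR_ge0 ?subr_ge0 ?(ltW ab)//.
  by rewrite -powRrM divff ?gt_eqF// powRr1.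
- rewrite subrr powRr0 mulr1; case: ifPn => // mu0; apply/ess_supP.
  apply: nearW => t /=; rewrite lee_fin indicE ger0_norm ?mulr_ge0//.
  by rewrite ler_piMr//; case: (_ \in _).
Qed.

End LnormTools.

(** * Smooth and glued curves in the phase spaces *)

Section Locality.
Context {R : realType} {n : nat}.
Implicit Types (x y z : R -> 'rV[R]_n) (r a b M : R).

Lemma derive1_eq_itv a b x y s : (forall t, a < t < b -> x t = y t) ->
  a < s < b -> derive1 x s = derive1 y s.
Proof.
move=> xy sab; rewrite !derive1E; apply: near_eq_derive.
have : s \in `]a, b[ by rewrite in_itv.
move=> /near_in_itvoo; apply: filterS => t; rewrite in_itv/=; exact: xy.
Qed.

Lemma history_quotient x t s :
  (fun h : R => h^-1 *: (history x t (h + s) - history x t s)) =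
  (fun h : R => h^-1 *: (x (h + (t + s)) - x (t + s))).
Proof. by apply/funext => h; rewrite /history addrCA. Qed.

Lemma derive1_history x t s : derive1 (history x t) s = derive1 x (t + s).
Proof. by rewrite /derive1 history_quotient. Qed.

Lemma derivable_history x t s :
  derivable x (t + s) 1 -> derivable (history x t) s 1.
Proof.
rewrite /derivable.
have -> : (fun h : R => h^-1 *: ((history x t \o shift s) (h *: (1:R)) - history x t s)) =
    (fun h => h^-1 *: ((x \o shift (t + s)) (h *: (1:R)) - x (t + s))) => //.
by apply/funext => h /=; rewrite /history addrCA.
Qed.

Lemma supnorm_eq r x y : (forall s, - r <= s <= 0 -> x s = y s) ->
  supnorm r x = supnorm r y.
Proof.
move=> xy; rewrite /supnorm; congr ereal_sup.
by apply: eq_imagel => s /=; rewrite in_itv/= => /xy ->.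
Qed.

Lemma holder_seminorm_eq r a x y : (forall s, - r <= s <= 0 -> x s = y s) ->
  holder_seminorm r a x = holder_seminorm r a y.
Proof.
move=> xy; rewrite /holder_seminorm; congr ereal_sup.
by apply: eq_imagel => -[s t] /=; rewrite !in_itv/= => -[/xy -> /xy -> _].
Qed.

Lemma speed_eq r x y t : (forall s, - r <= s <= 0 -> x s = y s) ->
  speed r x t = speed r y t.
Proof.
move=> xy; rewrite /speed patchE [in RHS]patchE.
have [|_] := boolP (t \in _); last exact: erefl.
rewrite inE/= in_itv/= => tr; congr enorm.
apply: (derive1_eq_itv (- r) 0 _ _ _ _ tr) => s /andP[/ltW rs /ltW s0].
by apply: xy; rewrite rs s0.
Qed.

Lemma deriv_Lnorm_eq r p x y : (forall s, - r <= s <= 0 -> x s = y s) ->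
  deriv_Lnorm r p x = deriv_Lnorm r p y.
Proof.
move=> xy; rewrite (deriv_LnormE r p x) (deriv_LnormE r p y).
by apply: eq_Lnorm => t /=; congr EFin; exact: speed_eq.
Qed.

End Locality.

Definition phase_space {R : realType} {n : nat} (r : R) (p : \bar R)
    (X : fun_space R n) : Prop :=
  X = sobolev r p \/ X = holder r (holder_exponent p).

(** Membership in the Sobolev space requires a measurable derivative, hence the
    last clause. *)
Definition C1_bound {R : realType} {n : nat} (a b M : R) (x : R -> 'rV[R]_n) :=
  (forall s, a < s < b -> derivable x s 1 /\ enorm (derive1 x s) <= M) /\
  (forall i, measurable_fun `]a, b[ (fun s => derive1 x s 0 i)).

Section PhaseSpace.
Context {R : realType} {n : nat} (r : R) (p : \bar R) (X : fun_space R n).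
Hypotheses (r_gt0 : 0 < r) (p_gt1 : (1 < p)%E) (XE : phase_space r p X).
Implicit Types (x y z : R -> 'rV[R]_n) (a b M A : R).
Local Notation mu := (@lebesgue_measure R).
Local Notation alpha := (holder_exponent p).
Local Notation Cr := (2 + r `^ (1 - alpha)).

Lemma Cr_gt0 : 0 < Cr.
Proof. by rewrite ltr_pwDl// powR_ge0. Qed.

Lemma space_norm_eq x y : (forall s, - r <= s <= 0 -> x s = y s) ->
  space_norm X x = space_norm X y.
Proof.
move=> xy; case: XE => -> /=.
  by rewrite (supnorm_eq r x y xy) (deriv_Lnorm_eq r p x y xy).
by rewrite (supnorm_eq r x y xy) (holder_seminorm_eq r _ x y xy).
Qed.

Lemma space_norm_ge0 x : (0 <= space_norm X x)%E.
Proof.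
have s0 := supnorm_ge0 r x (ltW r_gt0).
case: XE => -> /=; last by rewrite le_max s0.
by rewrite (adde_ge0 s0)//; exact: Lnorm_ge0.
Qed.

Lemma space_norm_sup x A : (space_norm X x <= A%:E)%E ->
  forall s, - r <= s <= 0 -> enorm (x s) <= A.
Proof.
move=> xA; apply/supnormP; apply: le_trans xA.
case: XE => -> /=; last by rewrite le_max lexx.
by rewrite leeDl//; exact: Lnorm_ge0.
Qed.

Lemma space_norm_fin x : carrier X x -> (space_norm X x < +oo)%E.
Proof.
have C0_fin z : C0 r z -> (supnorm r z < +oo)%E.
  move=> /(within_bounded (- r) 0)[M M0 zM].
  by apply: le_lt_trans (ltry M); apply/supnormP.
case: XE => -> /= -[].
  by move=> /abs_continuous_C0/C0_fin z [_ _ y]; rewrite lte_add_pinfty.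
by move=> /C0_fin z y; rewrite gt_max z.
Qed.

Lemma space_holder_ball x A : carrier X x -> (space_norm X x <= A%:E)%E ->
  (forall s, - r <= s <= 0 -> enorm (x s) <= A) /\
  (forall s t, - r <= s <= 0 -> - r <= t <= 0 ->
     enorm (x s - x t) <= A * `|s - t| `^ alpha).
Proof.
have a0 := holder_exponent_gt0 _ _ p_gt1.
move=> Xx xA; split; first exact: space_norm_sup.
move: Xx xA; case: XE => -> Xx xA.
  by case: (sobolev_holder_ball _ _ _ _ r_gt0 p_gt1 Xx xA).
move: xA; rewrite /= ge_max => /andP[sA]; apply: (holder_seminormP _ _ _ _ a0 _).1.
by rewrite -lee_fin; apply: le_trans sA; apply: supnorm_ge0; exact: ltW.
Qed.

(** |u - v| = |u - v|^(1 - a) |u - v|^a, and the first factor is at most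
    r^(1 - a). *)
Lemma lipschitz_holder x a b M : 0 <= M -> b - a <= r ->
  {within `[a, b], continuous x} -> C1_bound a b M x ->
  forall s t, a <= s <= b -> a <= t <= b ->
  enorm (x s - x t) <= M * r `^ (1 - alpha) * `|s - t| `^ alpha.
Proof.
move=> M0 bar xc [dx _] s t.
have a0 := holder_exponent_gt0 _ _ p_gt1.
wlog st : s t / s <= t.
  move=> H sab tab; have [/H|/ltW /H H'] := leP s t; first exact.
  by rewrite enormBC distrC; exact: H'.
move=> /andP[as_ sb] /andP[at_ tb].
rewrite enormBC distrC ger0_norm ?subr_ge0//.
apply: le_trans (lipschitz_of_derive _ _ M _ st _ _) _.
- by apply: continuous_subspaceW xc => u /=; rewrite !in_itv/= => /andP[? ?]; lra.
- by move=> u /andP[? ?]; apply: dx; lra.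
rewrite -mulrA ler_wpM2l//.
have ts0 : 0 <= t - s by rewrite subr_ge0.
rewrite -[leLHS]powRr1// -{1}(subrK alpha 1) powRD; last first.
  by rewrite subrK oner_eq0.
rewrite ler_wpM2r ?powR_ge0// ge0_ler_powR ?nnegrE ?(ltW r_gt0) ?subr_ge0//.
  exact: holder_exponent_le1.
lra.
Qed.

Lemma speed_le_cst x M : C1_bound (- r) 0 M x -> 0 <= M ->
  (deriv_Lnorm r p x <= (M * r `^ (1 - alpha))%:E)%E.
Proof.
move=> [dx mx] M0; rewrite deriv_LnormE.
have r0 : - r < 0 by rewrite oppr_lt0.
have := Lnorm_cst_indic p (- r) 0 M p_gt1 r0 M0.
rewrite sub0r opprK; apply: le_trans; apply: Lnorm_le_ae => //.
- exact: measurable_speed.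
- apply: measurable_funM; first exact: measurable_cst.
  exact: measurable_indic.
- exact: speed_ge0.
- apply: nearW => t; rewrite /speed patchE indicE.
  case: ifPn => [|_]; last by rewrite mulr0.
  by rewrite inE/= in_itv/= mulr1 => /dx[].
Qed.

(** A C^1 curve belongs to every phase space, with a norm controlled by its C^1
    bounds only.  This is how smoothing turns uniform smallness into smallness
    in X. *)
Lemma C1_in_space x M : 0 <= M ->
  {within `[- r, 0], continuous x} -> C1_bound (- r) 0 M x ->
  (forall s, - r <= s <= 0 -> enorm (x s) <= M) ->
  carrier X x /\ (space_norm X x <= (Cr * M)%:E)%E.
Proof.
move=> M0 xc xC1 xM; have [dx mx] := xC1.
have a0 := holder_exponent_gt0 _ _ p_gt1.
have sM : (supnorm r x <= M%:E)%E by apply/supnormP.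
have rr : 0 - - r <= r by rewrite sub0r opprK.
have C0 : 0 <= r `^ (1 - alpha) by exact: powR_ge0.
case: XE => -> /=; split.
- split.
    move=> e e0; exists (e / (M + 1)); first by rewrite divr_gt0// ltr_wpDl.
    move=> k u v uv _ lt_e.
    apply: (@le_lt_trans _ _ (\sum_(i < k) M * (v i - u i))).
      apply: ler_sum => i _; have [ru uv' v0] := uv i.
      apply: lipschitz_of_derive => //.
        by apply: continuous_subspaceW xc => w /=; rewrite !in_itv/= => /andP[? ?]; lra.
      by move=> w /andP[? ?]; apply: dx; lra.
    rewrite -mulr_sumr.
    have : (M + 1) * \sum_(i < k) (v i - u i) < e.
      by rewrite mulrC -ltr_pdivlMr// ltr_wpDl.
    apply: le_lt_trans; rewrite mulrDl lerDl mul1r sumr_ge0// => i _.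
    by rewrite subr_ge0; have [] := uv i.
  split => //.
    by apply: nearW => s; rewrite in_itv/= => /dx[].
  by apply: le_lt_trans (speed_le_cst _ _ xC1 M0) _; rewrite ltry.
- apply: le_trans (leeD sM (speed_le_cst _ _ xC1 M0)) _.
  rewrite -EFinD lee_fin; nra.
- split; first exact: xc.
  apply: (@le_lt_trans _ _ (M * r `^ (1 - alpha))%:E); last exact: ltry.
  apply/(holder_seminormP _ _ _ _ a0); first by rewrite mulr_ge0.
  exact: lipschitz_holder.
- rewrite ge_max; apply/andP; split.
    by apply: le_trans sM _; rewrite lee_fin; nra.
  apply: (@le_trans _ _ (M * r `^ (1 - alpha))%:E); last by rewrite lee_fin; nra.
  apply/(holder_seminormP _ _ _ _ a0); first by rewrite mulr_ge0.
  exact: lipschitz_holder.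
Qed.

Lemma measurable_translate_itv a b c (g : R -> R) :
  measurable_fun `](c + a), (c + b)[ g ->
  measurable_fun `]a, b[ (fun s => g (c + s)).
Proof.
move=> mg; apply: (@measurable_comp _ _ _ _ _ _ `](c + a), (c + b)[ g _ (translation c)) => //.
  by move=> _ [s /= + <-]; rewrite !in_itv/= /translation !ltrD2l.
by apply: measurable_funS (measurable_translation c).
Qed.

(** For t <= r the state at time t is x0 translated by t, followed by a C^1
    piece.  In the Sobolev case its speed is bounded, except at the junction
    - t, by the sum of the translated speed of x0 and of the constant M.  In the
    Hoelder case an increment across the junction is split at the junction. *)
Lemma history_space_bound x0 x t A M : carrier X x0 ->
  (space_norm X x0 <= A%:E)%E -> 0 <= t <= r -> 0 <= M ->
  (forall s, - r <= s <= 0 -> x s = x0 s) ->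
  {within `[- r, t], continuous x} -> C1_bound 0 t M x ->
  (forall s, 0 <= s <= t -> enorm (x s) <= M) ->
  (space_norm X (history x t) <= (Cr * (A + M))%:E)%E.
Proof.
move=> Xx0 x0A /andP[t0 tr] M0 xx0 xc xC1 xM.
have [dx mx] := xC1.
have a0 := holder_exponent_gt0 _ _ p_gt1.
have C0 : 0 <= r `^ (1 - alpha) by exact: powR_ge0.
have [x0s x0h] := space_holder_ball _ _ Xx0 x0A.
have A0 : 0 <= A.
  by rewrite -lee_fin (le_trans (space_norm_ge0 x0)).
have sM : (supnorm r (history x t) <= (A + M)%:E)%E.
  apply/supnormP => s /andP[rs s0]; rewrite /history.
  have [ts|ts] := leP 0 (t + s).
    by apply: le_trans (xM _ _) _; lra.
  by rewrite xx0; [apply: le_trans (x0s _ _) _; lra|lra].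
move: Xx0 x0A; case: XE => -> /= Xx0 x0A.
- apply: (@le_trans _ _ ((A + M)%:E + (A%:E + (M * r `^ (1 - alpha))%:E))%E); last first.
    by rewrite -!EFinD lee_fin; nra.
  apply: leeD => //; rewrite deriv_LnormE.
  have Lx0 : (deriv_Lnorm r p x0 <= A%:E)%E.
    by apply: le_trans x0A; rewrite leeDr// supnorm_ge0// ltW.
  have [_ [_ mx0 _]] := Xx0.
  have ms0 := measurable_speed _ _ mx0.
  have r0 : - r < 0 by rewrite oppr_lt0.
  have mC : measurable_fun setT (fun s => M * \1_`]- r, 0[%classic s : R).
    by apply: measurable_funM; [exact: measurable_cst|exact: measurable_indic].
  have mT : measurable_fun setT (speed r x0 \o translation t).
    by apply: measurableT_comp => //; exact: measurable_translation.
  have msx : measurable_fun setT (speed r (history x t)).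
    apply: measurable_speed => i.
    rewrite (_ : (fun s => _) = (fun s => derive1 x (t + s) 0 i)); last first.
      by apply/funext => s; rewrite derive1_history.
    apply: (measurable_translate_itv _ _ _ (fun s => derive1 x s 0 i)).
    rewrite addr0.
    have mU : measurable_fun (`]- r, 0[ `|` ([set 0] `|` `]0, t[)) (fun s => derive1 x s 0 i).
      apply/measurable_funU => //; first exact: measurableU.
      split; last first.
        apply/measurable_funU => //; split; last exact: mx.
        exact: measurable_fun_set1.
      apply: eq_measurable_fun (mx0 i) => s; rewrite inE/= in_itv/= => sr.
      suff -> : derive1 x s = derive1 x0 s by exact: erefl.
      apply: (derive1_eq_itv (- r) 0 _ _ _ _ sr) => u /andP[? ?].
      by rewrite xx0// !ltW.
    apply: measurable_funS mU; first by apply: measurableU => //; exact: measurableU.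
    move=> s /=; rewrite !in_itv/= => /andP[? st].
    have [s0|s0|->] := ltgtP s 0; [left; lra|right; right; lra|by right; left].
  apply: (@le_trans _ _ (Lnorm mu p (EFin \o ((speed r x0 \o translation t) \+
      (fun s => M * \1_`]- r, 0[%classic s))))).
    apply: (Lnorm_le_ae _ _ _ p_gt1 msx (measurable_funD mT mC) (speed_ge0 _ _)).
    (* The junction - t is the only point where the bound may fail. *)
    exists [set - t]; split => //; first exact: lebesgue_measure_set1.
    move=> s /= nle; apply: contrapT => /eqP st; apply: nle.
    have i0 u : 0 <= M * \1_`]- r, 0[%classic u by rewrite mulr_ge0.
    rewrite {1}/speed patchE; case: ifPn => [|_]; last first.
      by rewrite addr_ge0// speed_ge0.
    rewrite inE/= in_itv/= => sr; rewrite indicE mem_set ?mulr1/= ?in_itv//.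
    rewrite derive1_history; have [st'|st'|/eqP] := ltgtP s (- t).
    + apply: ler_wpDr => //.
      rewrite /speed patchE /translation mem_set/= ?in_itv/=; last lra.
      have -> : derive1 x (t + s) = derive1 x0 (t + s).
        apply: (derive1_eq_itv (- r) 0); last lra.
        by move=> u /andP[? ?]; rewrite xx0// !ltW.
      exact: lexx.
    + apply: ler_wpDl; first exact: speed_ge0.
      by have [] := dx (t + s); lra.
    + by rewrite (negbTE st).
  apply: le_trans (eminkowski _ mT mC (ltW p_gt1)) _.
  apply: leeD.
    apply: le_trans (Lnorm_translation _ _ _ p_gt1 ms0 (speed_ge0 _ _)) _.
    by rewrite -deriv_LnormE.
  by have := Lnorm_cst_indic _ _ _ _ p_gt1 r0 M0; rewrite sub0r opprK.
- rewrite ge_max; apply/andP; split.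
    by apply: le_trans sM _; rewrite lee_fin; nra.
  apply: (@le_trans _ _ (A + M * r `^ (1 - alpha))%:E); last by rewrite lee_fin; nra.
  apply/(holder_seminormP _ _ _ _ a0); first by rewrite addr_ge0// mulr_ge0.
  have xc' : {within `[0, t], continuous x}.
    by apply: continuous_subspaceW xc => u /=; rewrite !in_itv/= => /andP[? ?]; lra.
  have t0r : t - 0 <= r by rewrite subr0.
  have xh u v := lipschitz_holder _ _ _ _ M0 t0r xc' xC1 u v.
  move=> s u; wlog su : s u / s <= u.
    move=> H sab tab; have [/H|/ltW /H H'] := leP s u; first exact.
    by rewrite enormBC distrC; exact: H'.
  move=> /andP[rs s0] /andP[ru u0]; rewrite /history.
  have -> : `|s - u| = `|(t + s) - (t + u)| by congr (`|_|); ring.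
  set v := t + s; set w := t + u.
  have vw : v <= w by rewrite lerD2l.
  have vwa : 0 <= `|v - w| `^ alpha by exact: powR_ge0.
  have [v0|v0] := leP 0 v.
    have vt : 0 <= v <= t by move: v0; rewrite /v; lra.
    have wt : 0 <= w <= t by move: v0; rewrite /v /w; lra.
    by rewrite mulrDl; have := xh _ _ vt wt; have := mulr_ge0 A0 vwa; lra.
  have rv : - r <= v <= 0 by move: v0; rewrite /v; lra.
  have [w0|w0] := leP w 0.
    have rw : - r <= w <= 0 by move: w0; rewrite /w; lra.
    rewrite !xx0//; have := x0h _ _ rv rw.
    have : 0 <= M * r `^ (1 - alpha) * `|v - w| `^ alpha by rewrite !mulr_ge0.
    by lra.
  have wt : 0 <= w <= t by move: w0; rewrite /w; lra.
  have r00 : - r <= 0 <= (0 : R) by rewrite lexx oppr_le0 (ltW r_gt0).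
  have t00 : (0 : R) <= 0 <= t by rewrite t0 lexx.
  have h1 := x0h _ _ rv r00; have h2 := xh _ _ t00 wt.
  have p1 : `|v - 0| `^ alpha <= `|v - w| `^ alpha.
    rewrite ge0_ler_powR ?nnegrE ?(ltW a0)//.
    by rewrite subr0 !ltr0_norm ?subr_lt0//; lra.
  have p2 : `|0 - w| `^ alpha <= `|v - w| `^ alpha.
    rewrite ge0_ler_powR ?nnegrE ?(ltW a0)//.
    by rewrite sub0r !ltr0_norm ?subr_lt0 ?oppr_lt0//; lra.
  have q1 : A * `|v - 0| `^ alpha <= A * `|v - w| `^ alpha by rewrite ler_wpM2l.
  have q2 : M * r `^ (1 - alpha) * `|0 - w| `^ alpha <=
      M * r `^ (1 - alpha) * `|v - w| `^ alpha by rewrite ler_wpM2l// mulr_ge0.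
  apply: le_trans (ler_enorm_distD (x 0) _ _) _.
  rewrite xx0//; rewrite xx0// in h2 *.
  lra.
Qed.

End PhaseSpace.

(** * Solutions of the delay equation *)

(** The Lipschitz hypothesis with a fixed modulus L, in terms of pointwise
    bounds on [-r, 0] instead of extended suprema. *)
Definition lipschitz_with {R : realType} {n : nat} (r : R)
    (f : (R -> 'rV[R]_n) -> 'rV[R]_n) (L : R -> R) : Prop :=
  forall M, 0 <= M -> 0 <= L M /\
    forall x y d, C0 r x -> C0 r y ->
      (forall s, - r <= s <= 0 -> enorm (x s) <= M) ->
      (forall s, - r <= s <= 0 -> enorm (y s) <= M) ->
      (forall s, - r <= s <= 0 -> enorm (x s - y s) <= d) ->
      enorm (f x - f y) <= L M * d.

Section Solutions.
Context {R : realType} {n : nat} (r : R) (f : (R -> 'rV[R]_n) -> 'rV[R]_n).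
Hypotheses (r_gt0 : 0 < r) (f0 : f (cst 0) = 0).
Implicit Types (x y z : R -> 'rV[R]_n) (a b M A t : R).

Lemma lipschitz_on_boundedP : lipschitz_on_bounded r f ->
  exists L, lipschitz_with r f L.
Proof.
move=> [L [L0 _ Lf]]; exists L => M M0; split; first exact: L0.
move=> x y d cx cy xM yM xyd; rewrite -lee_fin.
rewrite EFinM.
apply: (@le_trans _ _ ((L M)%:E * supnorm r (x - y)%R)%E).
  by apply: Lf => //; apply/supnormP.
by rewrite lee_wpmul2l ?lee_fin ?L0//; apply/supnormP.
Qed.

Variable L : R -> R.
Hypothesis f_lip : lipschitz_with r f L.

Lemma solution_continuous x0 x a b : solution r f x0 x -> - r <= a ->
  {within `[a, b], continuous x}.
Proof.
move=> [_ xc _ _] ra; apply: continuous_subspaceW xc => s /=.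
by rewrite !in_itv/= => /andP[as_ _]; rewrite (le_trans ra).
Qed.

Lemma history_C0 x0 x t : solution r f x0 x -> 0 <= t -> C0 r (history x t).
Proof.
move=> sx t0; apply/C0P => s sr e e0.
have rtt : - r <= t - r by lra.
have /within_enormP xc := solution_continuous x0 x (t - r) t sx rtt.
have [|d d0 hd] := xc (t + s) _ e e0; first by rewrite /= in_itv/=; lra.
exists d => // u ur us; apply: hd; first by rewrite /= in_itv/=; lra.
by rewrite (_ : t + u - (t + s) = u - s); last ring.
Qed.

(** As f vanishes at 0, the velocity is small when the solution is; L is taken
    at an arbitrary M >= m so that the constant does not depend on m. *)
Lemma field_bound x0 x t m M : solution r f x0 x -> 0 <= t ->
  0 <= m -> m <= M -> (forall s, t - r <= s <= t -> enorm (x s) <= m) ->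
  enorm (f (history x t)) <= L M * m.
Proof.
move=> sx t0 m0 mM xm; have M0 := le_trans m0 mM; have [_ fL] := f_lip M M0.
have xtm s : - r <= s <= 0 -> enorm (history x t s) <= m.
  by move=> /andP[rs s0]; apply: xm; lra.
rewrite -[f _]subr0 -f0; apply: fL.
- exact: history_C0 sx t0.
- by move=> ?; exact: cvg_cst.
- by move=> s /xtm /le_trans; exact.
- by move=> s _; rewrite enorm0.
- by move=> s /xtm; rewrite subr0.
Qed.

Lemma solution_derive x0 x t : solution r f x0 x -> 0 < t ->
  derivable x t 1 /\ derive1 x t = f (history x t).
Proof.
move=> [_ _ _ dx] t0; have [d1 d2] := dx t t0.
by split; [exact: d1|rewrite derive1E d2].
Qed.

Lemma solution_coord_continuous x0 x i s : solution r f x0 x -> 0 < s ->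
  {for s, continuous (fun u => x u 0 i)}.
Proof.
move=> sx s0; apply/cvgrPdist_lt => e e0.
have r0 : - r <= 0 by rewrite oppr_le0 ltW.
have /within_enormP xc := solution_continuous x0 x 0 (s + 1) sx r0.
have [|d d0 hd] := xc s _ e e0; first by rewrite /= in_itv/=; lra.
apply/nbhs_ballP; exists (Num.min d (Num.min s 1)).
  by rewrite /= !lt_min d0 s0 ltr01.
move=> u; rewrite /ball/= !lt_min => /and3P[ud us u1].
have := coord_le_enorm (x u - x s) i; rewrite !mxE distrC => /le_lt_trans; apply.
apply: hd; last by rewrite distrC.
by rewrite /= in_itv/=; move: us u1; rewrite !ltr_norml => /andP[? ?] /andP[? ?]; lra.
Qed.

(** The derivative is the pointwise limit of the difference quotients with step
    1 / (k + 1), which are continuous. *)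
Lemma measurable_derive_solution x0 x a b i : solution r f x0 x -> 0 <= a ->
  measurable_fun `]a, b[ (fun s => derive1 x s 0 i).
Proof.
move=> sx a0.
pose q (k : nat) (s : R) := k.+1%:R * (x (s + k.+1%:R^-1) 0 i - x s 0 i).
apply: (@measurable_fun_cvg _ _ _ _ q).
  move=> k; apply: open_continuous_measurable_fun; first exact: interval_open.
  move=> s; rewrite inE/= in_itv/= => /andP[as_ _].
  have s0 : 0 < s by exact: le_lt_trans as_.
  have k0 : 0 < k.+1%:R^-1 :> R by rewrite invr_gt0.
  apply: cvgM; first exact: cvg_cst.
  apply: cvgB; last exact: solution_coord_continuous sx s0.
  apply: (@cvg_comp _ _ _ (fun u => u + k.+1%:R^-1) (fun v => x v 0 i) _
    (nbhs (s + k.+1%:R^-1))).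
    by apply: cvgD; [exact: cvg_id|exact: cvg_cst].
  by apply: (solution_coord_continuous _ _ i _ sx); rewrite addr_gt0.
move=> s /=; rewrite in_itv/= => /andP[as_ _].
have s0 : 0 < s by exact: le_lt_trans as_.
have [dx _] := solution_derive _ _ _ sx s0.
apply/cvgrPdist_le => e e0.
have [d d0 hd] := derivable_right_enorm _ _ _ dx e0.
have /cvgrPdist_lt/(_ _ d0) := @cvg_harmonic R.
apply: filterS => k; rewrite sub0r normrN gtr0_norm ?invr_gt0// => kd.
have k0 : 0 < k.+1%:R^-1 :> R by rewrite invr_gt0.
have := le_trans (coord_le_enorm _ i) (hd _ k0 kd).
rewrite !mxE => H; rewrite /q distrC.
have -> : k.+1%:R * (x (s + k.+1%:R^-1) 0 i - x s 0 i) - derive1 x s 0 i =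
    k.+1%:R * (x (s + k.+1%:R^-1) 0 i - x s 0 i - k.+1%:R^-1 * derive1 x s 0 i).
  by rewrite [in RHS]mulrBr mulrA divff// mul1r.
by rewrite normrM gtr0_norm// mulrC -ler_pdivlMr//.
Qed.

Lemma solution_C1_bound x0 x a b m M : solution r f x0 x -> 0 <= a ->
  0 <= m -> m <= M -> (forall s, a - r <= s <= b -> enorm (x s) <= m) ->
  C1_bound a b (L M * m) x.
Proof.
move=> sx a0 m0 mM xm; split => [s /andP[as_ sb]|i]; last first.
  exact: measurable_derive_solution sx a0.
have s0 : 0 < s by exact: le_lt_trans as_.
have [dx ->] := solution_derive _ _ _ sx s0; split => //.
apply: field_bound sx (ltW s0) m0 mM _ => u /andP[? ?]; apply: xm; lra.
Qed.

(** Gronwall's inequality.  The strict bound |x - y| < e exp(K t) is propagated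
    by induction on t: as long as it holds, |y| <= M + 1, so that the same
    Lipschitz constant K = L(M + 1) applies and the derivative of x - y is
    bounded by the derivative of e exp(K t); since |x - y| <= d < e initially the
    bound stays strict. *)
Lemma continuous_dependence x0 y0 x y M T d e :
  solution r f x0 x -> solution r f y0 y -> 0 <= M -> 0 <= T ->
  (forall s, - r <= s <= T -> enorm (x s) <= M) ->
  (forall s, - r <= s <= 0 -> enorm (x0 s - y0 s) <= d) ->
  d < e -> e * expR (L (M + 1) * T) <= 1 ->
  forall s, - r <= s <= T -> enorm (x s - y s) <= e * expR (L (M + 1) * T).
Proof.
move=> sx sy M0 T0 xM xyd de eT; have r0 := r_gt0.
have M10 : 0 <= M + 1 by rewrite addr_ge0.
have [K0 fL] := f_lip _ M10; set K := L (M + 1) in K0 fL eT *.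
have z0 s : - r <= s <= 0 -> enorm (x s - y s) <= d.
  move=> sr; have [xx _ _ _] := sx; have [yy _ _ _] := sy.
  by rewrite xx ?yy ?in_itv//; exact: xyd.
have d0 : 0 <= d.
  by apply: le_trans (z0 0 _); [exact: enorm_ge0|rewrite lexx oppr_le0 ltW].
have e0 : 0 < e by exact: le_lt_trans de.
have exp_mono s t : s <= t -> e * expR (K * s) <= e * expR (K * t).
  by move=> st; rewrite ler_pM2l// ler_expR ler_wpM2l.
have exp_ge1 t : 0 <= t -> e <= e * expR (K * t).
  by move=> t0; have := exp_mono 0 t t0; rewrite mulr0 expR0 mulr1.
have zc : {within `[- r, T], continuous (x - y)}.
  have xc := solution_continuous _ _ (- r) T sx (lexx _).
  have yc := solution_continuous _ _ (- r) T sy (lexx _).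
  by move=> s; exact: (cvgB (xc s) (yc s)).
have main t : 0 <= t <= T -> enorm (x t - y t) < e * expR (K * t).
  move=> tI; apply: (real_induction 0 T (fun t =>
    enorm (x t - y t) < e * expR (K * t)) _ _ t tI) => {tI}t /andP[t0 tT]; last first.
    move=> Pt; have /within_enormP zc' := zc.
    have Pt' : 0 < e * expR (K * t) - enorm (x t - y t) by rewrite subr_gt0.
    have tI : `[- r, T]%classic t by rewrite /= in_itv/=; lra.
    have [h h0 hh] := zc' t tI _ Pt'.
    exists (Num.min h (T - t)); first by rewrite lt_min h0 subr_gt0.
    move=> u tu; rewrite -ltrBlDl lt_min => /andP[uh uT].
    have uI : `[- r, T]%classic u by rewrite /= in_itv/=; lra.
    have := hh u uI; rewrite gtr0_norm ?subr_gt0// => /(_ uh) H.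
    apply: lt_le_trans (exp_mono t u (ltW tu)).
    rewrite -[_ - y u](subrK (x t - y t)) (le_lt_trans (ler_enormD _ _))//.
    by rewrite -ltrBrDr.
  move=> Pu.
  have zK s : - r <= s < t -> enorm (x s - y s) <= e * expR (K * s) \/ s <= 0.
    move=> /andP[rs st]; have [s0|] := leP s 0; [by right|left].
    by apply/ltW/Pu; rewrite st ltW.
  have zs s u : - r <= s -> s <= u -> 0 <= u -> u < t ->
      enorm (x s - y s) <= e * expR (K * u).
    move=> rs su u0 ut.
    have [|/le_trans->//|s0] := zK s; first by rewrite rs (le_lt_trans su).
      exact: exp_mono.
    have sr0 : - r <= s <= 0 by rewrite rs.
    by rewrite (le_trans (z0 _ sr0))// (le_trans (ltW de))// exp_ge1.
  have : enorm ((x - y) t - (x - y) 0) <= e * expR (K * t) - e * expR (K * 0).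
    apply: (growth_derivable _ _ _ (fun t => e * expR (K * t))) => //.
    - by apply: continuous_subspaceW zc => u /=; rewrite !in_itv/= => /andP[? ?]; lra.
    - by move=> s u _ su _; exact: exp_mono.
    move=> s /andP[s0 st].
    have [dx xE] := solution_derive _ _ _ sx s0.
    have [dy yE] := solution_derive _ _ _ sy s0.
    have dG : is_derive s (1:R) (fun t : R => e * expR (K * t)) (e * (expR (K * s) * K)).
      apply: (@is_deriveZ _ _ _ (expR \o (fun t : R => K * t)) e s 1).
      exact: (is_derive1_comp (is_derive_expR (K * s)) (is_derive_mull K s)).
    have [dG1 dG2] := dG.
    split; [exact: derivableB|exact: dG1|].
    rewrite [leRHS](derive1E (fun t => e * expR (K * t))) dG2.
    rewrite (derive1E (x - y)) (deriveB dx dy) -(derive1E x) -(derive1E y) xE yE.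
    rewrite [X in e * X]mulrC mulrCA; apply: fL.
    - exact: history_C0 sx (ltW s0).
    - exact: history_C0 sy (ltW s0).
    - move=> u /andP[ru u0]; apply: le_trans (xM _ _) _; last by rewrite lerDl.
      lra.
    - move=> u /andP[ru u0]; rewrite /history.
      have := ler_enormB (x (s + u)) (x (s + u) - y (s + u)).
      rewrite subKr => /le_trans; apply; apply: lerD; first by apply: xM; lra.
      apply: le_trans (zs _ s _ _ (ltW s0) st) _; [lra|lra|].
      apply: le_trans eT; apply: exp_mono; lra.
    - move=> u /andP[ru u0]; rewrite /history; apply: zs => //; [lra|lra|exact: ltW].
  rewrite mulr0 expR0 mulr1.
  have := z0 0; rewrite lexx oppr_le0 (ltW r_gt0) => /(_ isT).
  rewrite [(x - y) t]/= [(x - y) 0]/=.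
  have := ler_enormD (x t - y t - (x 0 - y 0)) (x 0 - y 0); rewrite subrK.
  rewrite (_ : (x - y) t = x t - y t)// (_ : (x - y) 0 = x 0 - y 0)//.
  lra.
move=> s /andP[rs sT]; have [s0|s0] := leP 0 s.
  by rewrite (le_trans (ltW (main s _)))// ?exp_mono// s0.
rewrite (le_trans (z0 _ _)) ?rs ?(ltW s0)// (le_trans (ltW de))//.
exact: exp_ge1.
Qed.

(** Continuous dependence with equal initial data, for arbitrarily small e. *)
Lemma solution_unique x0 x y : solution r f x0 x -> solution r f x0 y ->
  forall t, - r <= t -> x t = y t.
Proof.
move=> sx sy t rt; apply/eqP; rewrite -subr_eq0; apply/eqP; apply: enorm_eq0.
apply/eqP; rewrite eq_le enorm_ge0 andbT; apply/ler_addgt0Pr => k k0; rewrite add0r.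
pose T := `|t|.
have [M M0 xM] := within_bounded _ _ _ (solution_continuous _ _ (- r) T sx (lexx _)).
pose m := Num.min k 1.
have m0 : 0 < m by rewrite lt_min k0 ltr01.
(* e is chosen so that e exp(K T) = m, which is at most both k and 1. *)
pose e := m / expR (L (M + 1) * T).
have e0 : 0 < e by rewrite divr_gt0// expR_gt0.
have eE : e * expR (L (M + 1) * T) = m by rewrite divfK// gt_eqF// expR_gt0.
have := continuous_dependence x0 x0 x y M T 0 e sx sy M0 (normr_ge0 _) xM.
rewrite eE ge_min lexx orbT => H.
apply: le_trans (_ : m <= k); last by rewrite ge_min lexx.
apply: H => //; first by move=> s _; rewrite subrr enorm0.
by rewrite rt ler_norm.
Qed.

Lemma solution_history x0 x t : solution r f x0 x -> 0 <= t ->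
  solution r f (history x t) (history x t).
Proof.
move=> sx t0; have [xx xc x'0 dx] := sx.
have hh u : history (history x t) u = history x (t + u).
  by apply/funext => s; rewrite /history addrA.
split; first by [].
- move/within_enormP : xc => xc; apply/within_enormP => s.
  rewrite /= in_itv/= andbT => rs e e0.
  have [|d d0 hd] := xc (t + s) _ e e0; first by rewrite /= in_itv/= andbT; lra.
  exists d => // u; rewrite /= in_itv/= andbT => ru us.
  apply: hd; first by rewrite /= in_itv/= andbT; lra.
  by rewrite (_ : t + u - (t + s) = u - s); last ring.
- rewrite hh addr0.
  have [t00|tn0] := eqVneq t 0.
    rewrite t00 (_ : history x 0 = x) in x'0 *; first exact: x'0.
    by apply/funext => s; rewrite /history add0r.
  have tp : 0 < t by rewrite lt0r tn0.
  have [dxt xE] := solution_derive _ _ _ sx tp.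
  apply/enorm_cvgP => e e0.
  have [d d0 hd] := derivable_right_enorm _ _ _ dxt (ltac:(exact: divr_gt0 e0 (ltr0n _ 2)) : 0 < e / 2).
  near=> h.
  have h0 : 0 < h by near: h; exact: nbhs_right_gt.
  have hltd : h < d by near: h; exact: nbhs_right_lt.
  have := hd _ h0 hltd; rewrite xE /history addr0 => H.
  have -> : h^-1 *: (x (t + h) - x t) - f (history x t) =
     h^-1 *: (x (t + h) - x t - h *: f (history x t)).
    by rewrite [in RHS]scalerBr scalerA mulVf ?gt_eqF// scale1r.
  rewrite enormZ gtr0_norm ?invr_gt0// mulrC ltr_pdivrMr//.
  by apply: le_lt_trans H _; rewrite ltr_pM2r// ltr_pdivrMr// ltr_pMr// ltr1n.
- move=> s s0; rewrite hh.
  have ts : 0 < t + s by rewrite ltr_wpDl.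
  have [dxt xE] := solution_derive _ _ _ sx ts.
  have dh := derivable_history _ _ _ dxt.
  by apply: DeriveDef => //; rewrite -derive1E derive1_history.
Unshelve. all: by end_near. Qed.

(** phi is defined by choosing a solution; uniqueness makes the choice
    irrelevant on the relevant interval. *)
Lemma phi_history x0 x t s : solution r f x0 x -> 0 <= t -> - r <= s ->
  phi r f t x0 s = history x t s.
Proof.
move=> sx t0 rs; rewrite /phi /history.
apply: (solution_unique x0); last lra; last exact: sx.
by apply: (@xgetPex _ (cst 0) [set y | solution r f x0 y]); exists x.
Qed.

End Solutions.

(** * Compactness of Hoelder balls *)

Section HolderBall.
Context {R : realType} {n : nat} (r a : R).
Hypotheses (r_gt0 : 0 < r) (a_gt0 : 0 < a).
Implicit Types (A : R).
Local Notation curve := (prod_topology (fun _ : R => 'rV[R]_n)).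
Implicit Types (x y : curve).

Definition holder_ball A : set (R -> 'rV[R]_n) :=
  [set x | (forall s, - r <= s <= 0 -> enorm (x s) <= A) /\
     (forall s t, - r <= s <= 0 -> - r <= t <= 0 ->
        enorm (x s - x t) <= A * `|s - t| `^ a)].

Lemma holder_modulus A (e : R) : 0 <= A -> 0 < e ->
  exists2 d, 0 < d & forall h : R, `|h| < d -> A * `|h| `^ a <= e.
Proof.
move=> A0 e0; pose c := e / (A + 1).
have A1 : 0 < A + 1 by rewrite ltr_wpDl.
have c0 : 0 < c by rewrite divr_gt0.
have Ac : A * c <= e.
  by rewrite /c mulrA ler_pdivrMr// mulrC ler_pM2l// lerDl.
exists (c `^ a^-1) => [|h hd]; first by rewrite powR_gt0.
apply: le_trans Ac; rewrite ler_wpM2l//.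
have -> : c = (c `^ a^-1) `^ a by rewrite -powRrM mulVf ?gt_eqF// powRr1// ltW.
by rewrite ge0_ler_powR ?nnegrE ?(ltW a_gt0) ?powR_ge0 ?(ltW hd).
Qed.

Lemma holder_ball_carrier A (x : R -> 'rV[R]_n) : 0 <= A -> holder_ball A x ->
  carrier (holder r a) x.
Proof.
move=> A0 [_ xA]; split.
  apply/C0P => s sr e e0; have e2 : 0 < e / 2 by rewrite divr_gt0.
  have [d d0 Ad] := holder_modulus A (e / 2) A0 e2.
  exists d => // t tr /Ad h; apply: le_lt_trans (xA _ _ tr sr) _.
  by apply: le_lt_trans h _; rewrite ltr_pdivrMr// ltr_pMr// ltr1n.
apply: (@le_lt_trans _ _ A%:E); last exact: ltry.
exact/(holder_seminormP _ _ _ _ a_gt0).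
Qed.

Lemma enorm_closed_ball_compact A : compact [set v : 'rV[R]_n | enorm v <= A].
Proof.
apply: bounded_closed_compact.
  exists A; split; first exact: num_real.
  by move=> M AM v /= vA; rewrite (le_trans (norm_le_enorm _))// (le_trans vA)// ltW.
move=> v cv /=; apply/ler_addgt0Pr => e e0.
have nv : \forall u \near v, enorm (u - v) < e.
  have /enorm_cvgP/(_ e e0) : (fun u : 'rV[R]_n => u) @ v --> v by exact: cvg_id.
  exact.
have [u [/= uA uv]] := cv _ nv.
by have := ler_enormD u (v - u); rewrite subrKC (enormBC v); lra.
Qed.

Lemma near_eval x s (e : R) : 0 < e -> \forall y \near x, enorm (y s - x s) < e.
Proof.
move=> e0; have xs : (fun y : curve => y s) @ x --> x s.
  exact: (@proj_continuous R (fun _ => 'rV[R]_n) s x).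
by move/enorm_cvgP : xs; apply.
Qed.

(** Compactness for pointwise convergence on the whole line needs the values
    outside [-r, 0] to be pinned; they are set to 0. *)
Definition truncated_ball A : set curve :=
  [set x | holder_ball A x /\ forall s, ~~ (- r <= s <= 0) -> x s = 0].

(** The ball is closed under pointwise convergence and contained in a product of
    compact balls, so that the theorem of Tychonoff applies. *)
Lemma compact_truncated_ball A : 0 <= A -> compact (truncated_ball A).
Proof.
move=> A0.
have cB := @tychonoff R (fun _ => 'rV[R]_n) (fun _ => [set v | enorm v <= A])
  (fun _ => enorm_closed_ball_compact A).
apply: subclosed_compact cB _ => [x cx|x [[xA _] x0] s]; last first.
  have [/xA//|/x0 ->] := boolP (- r <= s <= 0).
  by rewrite /= enorm0.
have approx s t e : 0 < e -> exists y, [/\ truncated_ball A y,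
    enorm (y s - x s) < e & enorm (y t - x t) < e].
  move=> e0; have [|y [Ky [/= ys yt]]] := cx [set y | enorm (y s - x s) < e /\ enorm (y t - x t) < e].
    by apply: filterI; exact: near_eval.
  by exists y.
split; [split|].
- move=> s sr; apply/ler_addgt0Pr => e e0.
  have [y [[[yA _] _] ys _]] := approx s s e e0.
  by have := ler_enormB (y s) (y s - x s); rewrite subKr; have := yA s sr; lra.
- move=> s t sr tr; apply/ler_addgt0Pr => e e0.
  have e2 : 0 < e / 2 by rewrite divr_gt0.
  have [y [[[_ yA] _] ys yt]] := approx s t _ e2.
  have := yA s t sr tr; have := ler_enorm_distD (y s) (x s) (x t).
  have := ler_enorm_distD (y t) (y s) (x t).
  by rewrite (enormBC (x s) (y s)); lra.
- move=> s sr; apply: enorm_eq0; apply/eqP; rewrite eq_le enorm_ge0 andbT.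
  apply/ler_addgt0Pr => e e0; have [y [[_ y0] + _]] := approx s s e e0.
  by rewrite y0// sub0r enormN add0r => /ltW.
Qed.

(** For a uniformly Hoelder family pointwise convergence is uniform: close values
    at s control the values near s, and [-r, 0] is compact. *)
Lemma near_truncated_ball A x e : 0 <= A -> 0 < e -> truncated_ball A x ->
  \forall y \near x, truncated_ball A y ->
    forall s, - r <= s <= 0 -> enorm (x s - y s) <= e.
Proof.
move=> A0 e0 Kx.
have e3 : 0 < e / 3 by rewrite divr_gt0.
have [d d0 Ad] := holder_modulus A (e / 3) A0 e3.
have small y s t : truncated_ball A y -> - r <= s <= 0 -> - r <= t <= 0 ->
    `|s - t| < d -> enorm (y s - y t) <= e / 3.
  by move=> [[_ yA] _] sr tr /Ad; exact: le_trans (yA s t sr tr).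
have /compact_near_coveringP/near_covering_withinP := @segment_compact R (- r) 0.
move=> /(_ _ (nbhs x) (fun y s => truncated_ball A y -> enorm (x s - y s) <= e) _).
have H : forall s, `[- r, 0]%classic s -> \forall s' \near s & y \near x,
    `[- r, 0]%classic s' -> truncated_ball A y -> enorm (x s' - y s') <= e.
  move=> s; rewrite /= in_itv/= => sr.
  exists ([set s' | `|s - s'| < d], [set y | enorm (y s - x s) < e / 3]).
    split; last by apply: near_eval; rewrite divr_gt0.
    by apply/nbhs_ballP; exists d.
  move=> [s' y] [/= ss' ys]; rewrite in_itv/= => sr' Ky.
  have h1 := small x s s' Kx sr sr' ss'; have h2 := small y s s' Ky sr sr' ss'.
  have := ler_enorm_distD (x s) (x s') (y s').
  have := ler_enorm_distD (y s) (x s) (y s').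
  by rewrite (enormBC (x s) (y s)) (enormBC (x s') (x s)); lra.
move=> /(_ H); apply: filterS => y Hy Ky s sr; exact: Hy.
Qed.

(** Arzela and Ascoli in the form needed here: a property of initial data that
    holds locally, for uniform convergence, beyond some time or bound, holds on
    the whole Hoelder ball from a common time or bound on. *)
Lemma holder_ball_cover A (P : (R -> 'rV[R]_n) -> R -> Prop) : 0 <= A ->
  (forall x, holder_ball A x -> exists e T, 0 < e /\
     forall y, holder_ball A y ->
     (forall s, - r <= s <= 0 -> enorm (x s - y s) <= e) ->
     forall T', T <= T' -> P y T') ->
  exists2 T, 0 <= T & forall y, holder_ball A y -> P y T.
Proof.
move=> A0 loc.
have /compact_near_coveringP/near_covering_withinP := compact_truncated_ball A A0.
move=> /(_ R +oo%R (fun T x => forall y, holder_ball A y ->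
   (forall s, - r <= s <= 0 -> y s = x s) -> P y T) _).
have H x : truncated_ball A x -> \forall x' \near x & T \near +oo,
    truncated_ball A x' -> forall y, holder_ball A y ->
   (forall s, - r <= s <= 0 -> y s = x' s) -> P y T.
  move=> Kx; have [e [T [e0 eT]]] := loc x Kx.1.
  exists ([set x' | truncated_ball A x' -> forall s, - r <= s <= 0 -> enorm (x s - x' s) <= e],
    [set T' | T <= T']).
    split; first exact: near_truncated_ball.
    by apply: nbhs_pinfty_ge; exact: num_real.
  move=> [x' T'] [/= xx' TT'] Kx' y By yx'; apply: eT => //.
  by move=> s sr; rewrite yx'//; exact: xx'.
move=> /(_ H) [T0 [_ nT]].
have TT0 : T0 < Num.max 0 (T0 + 1) by rewrite lt_max ltrDl ltr01 orbT.
exists (Num.max 0 (T0 + 1)); first by rewrite le_max lexx.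
move=> y By.
pose y' : curve := fun s => if - r <= s <= 0 then y s else 0.
have yy' s : - r <= s <= 0 -> y s = y' s by rewrite /y' => ->.
have Ky' : truncated_ball A y'.
  split; last by move=> s /negbTE; rewrite /y' => ->.
  have [h1 h2] := By; split=> [s sr|s t sr tr]; rewrite -!yy'//.
    exact: h1.
  exact: h2.
exact: (nT _ TT0 y' Ky').
Qed.

End HolderBall.

(** * Majorants of class KL *)

Section KLMajorant.
Context {R : realType} (m : R -> R -> R).
Hypotheses
  (m_ge0 : forall s t, 0 <= s -> 0 <= t -> 0 <= m s t)
  (m_nd : forall s s' t, 0 <= s -> s <= s' -> 0 <= t -> m s t <= m s' t)
  (m_ni : forall s t t', 0 <= s -> 0 <= t -> t <= t' -> m s t' <= m s t)
  (m_attr : forall s e, 0 <= s -> 0 < e -> exists2 T, 0 <= T & m s T <= e)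
  (m_small : forall e, 0 < e -> exists2 d, 0 < d & m d 0 <= e).

Definition cutoff (v : R) : R := Num.max 0 (Num.min 1 (v - 1)).

Lemma cutoff_ge0 v : 0 <= cutoff v.
Proof. by rewrite le_max lexx. Qed.

Lemma cutoff_le1 v : cutoff v <= 1.
Proof. by rewrite ge_max ler01 ge_min lexx. Qed.

Lemma cutoff1 v : 2 <= v -> cutoff v = 1.
Proof. by move=> v2; rewrite /cutoff min_l ?max_r//; lra. Qed.

Lemma cutoff0 v : v <= 1 -> cutoff v = 0.
Proof. by move=> v1; rewrite /cutoff min_r ?max_l//; lra. Qed.

Lemma cutoff_nd v w : v <= w -> cutoff v <= cutoff w.
Proof.
move=> vw; have vw1 : v - 1 <= w - 1 by lra.
rewrite /cutoff !maxEle !minEle.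
case: (leP 1 (v - 1)) => ?; case: (leP 1 (w - 1)) => ?;
  repeat match goal with
  | |- context [if 0 <= ?c then _ else _] => case: (leP 0 c) => ?
  end; lra.
Qed.

Lemma cutoff_lip v w : v <= w -> cutoff w <= cutoff v + (w - v).
Proof.
move=> vw; rewrite /cutoff !maxEle !minEle.
case: (leP 1 (v - 1)) => ?; case: (leP 1 (w - 1)) => ?;
  repeat match goal with
  | |- context [if 0 <= ?c then _ else _] => case: (leP 0 c) => ?
  end; lra.
Qed.

(** A continuous majorant of m in its first variable.  The weight equals 1 for
    u <= s, which gives m <= smoothed, and 0 for u >= 2 s, which gives
    smoothed s t <= m (2 s) t; in between it makes smoothed locally Lipschitz. *)
Definition smoothed (s t : R) : R :=
  sup [set y | exists2 u, 0 < u & y = m u t * cutoff (2 * s / u)].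

Lemma smoothed_ub s t : 0 <= s -> 0 <= t ->
  ubound [set y | exists2 u, 0 < u & y = m u t * cutoff (2 * s / u)] (m (2 * s) t).
Proof.
move=> s0 t0 _ [u u0 ->]; have s20 : 0 <= 2 * s by rewrite mulr_ge0.
have [us|su] := leP u (2 * s).
  apply: le_trans (_ : m u t <= _); last exact: m_nd (ltW u0) us t0.
  by rewrite ler_piMr ?cutoff_le1// m_ge0// ltW.
rewrite cutoff0 ?mulr0 ?m_ge0// ler_pdivrMr// mul1r ltW//.
Qed.

Lemma smoothed_nonempty s t :
  [set y | exists2 u, 0 < u & y = m u t * cutoff (2 * s / u)] !=set0.
Proof. by exists (m 1 t * cutoff (2 * s / 1)); exists 1. Qed.

Lemma smoothed_le s t : 0 <= s -> 0 <= t -> smoothed s t <= m (2 * s) t.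
Proof.
by move=> s0 t0; apply: ge_sup; [exact: smoothed_nonempty|exact: smoothed_ub].
Qed.

Lemma smoothed_term s t u : 0 <= s -> 0 <= t -> 0 < u ->
  m u t * cutoff (2 * s / u) <= smoothed s t.
Proof.
move=> s0 t0 u0; apply: ub_le_sup; last by exists u.
by exists (m (2 * s) t); exact: smoothed_ub.
Qed.

Lemma smoothed_leP s t b :
  (forall u, 0 < u -> m u t * cutoff (2 * s / u) <= b) -> smoothed s t <= b.
Proof.
by move=> H; apply: ge_sup; [exact: smoothed_nonempty|move=> _ [u /H ? ->]].
Qed.

Lemma smoothed_ge0 s t : 0 <= s -> 0 <= t -> 0 <= smoothed s t.
Proof.
move=> s0 t0; apply: le_trans (smoothed_term s t 1 s0 t0 ltr01).
by rewrite mulr_ge0 ?cutoff_ge0 ?m_ge0.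
Qed.

Lemma smoothed0 t : 0 <= t -> smoothed 0 t = 0.
Proof.
move=> t0; apply/eqP; rewrite eq_le smoothed_ge0// andbT.
by apply: smoothed_leP => u _; rewrite cutoff0 ?mulr0 ?mul0r.
Qed.

Lemma smoothed_ge s t : 0 < s -> 0 <= t -> m s t <= smoothed s t.
Proof.
move=> s0 t0; have := smoothed_term s t s (ltW s0) t0 s0.
by rewrite cutoff1 ?mulr1// mulfK ?gt_eqF.
Qed.

Lemma smoothed_nd s s' t : 0 <= s -> s <= s' -> 0 <= t ->
  smoothed s t <= smoothed s' t.
Proof.
move=> s0 ss t0; apply: smoothed_leP => u u0.
apply: le_trans (smoothed_term s' t u (le_trans s0 ss) t0 u0).
rewrite ler_wpM2l ?m_ge0 ?(ltW u0)// cutoff_nd// ler_pM2r ?invr_gt0//.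
by rewrite ler_pM2l.
Qed.

Lemma smoothed_ni s t t' : 0 <= s -> 0 <= t -> t <= t' ->
  smoothed s t' <= smoothed s t.
Proof.
move=> s0 t0 tt; apply: smoothed_leP => u u0.
apply: le_trans (smoothed_term s t u s0 t0 u0).
by rewrite ler_wpM2r ?cutoff_ge0// m_ni// ltW.
Qed.

(** Terms with u <= s already have weight 1 in smoothed s t, terms with u beyond
    2 s' vanish in smoothed s' t, and for the others the weights differ by at
    most 2 (s' - s) / s. *)
Lemma smoothed_lip s s' t : 0 < s -> s <= s' -> 0 <= t ->
  smoothed s' t <= smoothed s t + 2 * (s' - s) / s * m (2 * s') t.
Proof.
move=> s0 ss t0; apply: smoothed_leP => u u0.
have s'0 : 0 < s' by exact: lt_le_trans ss.
have e0 : 0 <= 2 * (s' - s) / s.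
  by rewrite divr_ge0 ?mulr_ge0 ?subr_ge0// ltW.
have ms : 0 <= m (2 * s') t by apply: m_ge0 => //; rewrite mulr_ge0// ltW.
have mu : 0 <= m u t by rewrite m_ge0// ltW.
have em : 0 <= 2 * (s' - s) / s * m (2 * s') t by rewrite mulr_ge0.
have [us|su] := leP u s.
  have := smoothed_term s t u (ltW s0) t0 u0.
  rewrite (cutoff1 (2 * s / u)); last by rewrite ler_pdivlMr// ler_pM2l.
  have : m u t * cutoff (2 * s' / u) <= m u t * 1 by rewrite ler_wpM2l ?cutoff_le1.
  by lra.
have [us'|su'] := leP u (2 * s'); last first.
  rewrite cutoff0 ?mulr0; last by rewrite ler_pdivrMr// mul1r ltW.
  by rewrite addr_ge0// smoothed_ge0// ltW.
have vw : 2 * s / u <= 2 * s' / u by rewrite ler_pM2r ?invr_gt0// ler_pM2l.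
have := smoothed_term s t u (ltW s0) t0 u0.
have : m u t * cutoff (2 * s' / u) <=
    m u t * (cutoff (2 * s / u) + (2 * s' / u - 2 * s / u)).
  by rewrite ler_wpM2l// cutoff_lip.
suff : m u t * (2 * s' / u - 2 * s / u) <= 2 * (s' - s) / s * m (2 * s') t.
  by rewrite mulrDr; lra.
rewrite mulrC ler_pM//.
- by rewrite subr_ge0.
- rewrite -mulrBl -mulrBr ler_wpM2l ?mulr_ge0 ?subr_ge0//.
  by rewrite lef_pV2 ?posrE// ltW.
- exact: m_nd (ltW u0) us' t0.
Qed.

(** The second term makes the majorant strictly increasing in s. *)
Definition kl_majorant (s t : R) : R := smoothed s t + s / (1 + t).

Lemma kl_majorant_ge s t : 0 <= s -> 0 <= t -> m s t <= kl_majorant s t.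
Proof.
rewrite le_eqVlt => /predU1P[<-|s0] t0; last first.
  by rewrite (le_trans (smoothed_ge _ _ s0 t0))// lerDl divr_ge0 ?addr_ge0// ltW.
rewrite /kl_majorant smoothed0// mul0r addr0.
apply/ler_addgt0Pr => e /m_small[d d0 de]; rewrite add0r.
apply: le_trans de; apply: le_trans (m_ni _ _ _ _ _ t0) _ => //.
exact: m_nd (ltW d0) _.
Qed.

Lemma kl_majorant_continuous t : 0 <= t ->
  {within `[0, +oo[, continuous (fun s => kl_majorant s t)}.
Proof.
move=> t0.
have t1 : 0 < 1 + t by rewrite ltr_pwDl.
have lin : {within `[0, +oo[, continuous (fun s : R => s / (1 + t))}.
  apply: continuous_subspaceT => s; apply: cvgM; [exact: cvg_id|exact: cvg_cst].
suff sm : {within `[0, +oo[, continuous (fun s => smoothed s t)}.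
  by move=> s; exact: (cvgD (sm s) (lin s)).
apply/subspace_continuousP => s /=; rewrite in_itv/= andbT => s0.
apply/cvgrPdist_le => e e0; rewrite /from_subspace /=.
move: s0; rewrite le_eqVlt => /predU1P[<-|s0].
  have [d d0 de] := m_small e e0.
  apply/nbhs_ballP; exists (d / 2); first by rewrite /= divr_gt0.
  move=> u; rewrite /ball/= sub0r normrN in_itv/= andbT => ud u0.
  rewrite smoothed0// sub0r normrN ger0_norm ?smoothed_ge0//.
  rewrite (le_trans (smoothed_le _ _ u0 t0))//.
  move: ud; rewrite ger0_norm// => ud.
  apply: le_trans de; apply: le_trans (m_ni _ _ _ _ _ t0) _ => //.
    by rewrite mulr_ge0.
  by apply: m_nd; rewrite ?mulr_ge0//; lra.
pose C := 4 / s * m (4 * s) t + 1.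
have ms0 : 0 <= m (4 * s) t by apply: m_ge0 => //; rewrite mulr_ge0// ltW.
have C0 : 0 < C by rewrite ltr_wpDl// mulr_ge0// divr_ge0// ltW.
(* 2 (w - u) / u * m (2 w) is at most C (w - u) as u >= s / 2 and w <= 2 s. *)
have key u w : s / 2 <= u -> u <= w -> w <= 2 * s ->
    `|smoothed w t - smoothed u t| <= C * (w - u).
  move=> su uw ws; have u0 : 0 < u by apply: lt_le_trans su; rewrite divr_gt0.
  have w0 : 0 < w by exact: lt_le_trans uw.
  rewrite ger0_norm ?subr_ge0 ?smoothed_nd// ?(ltW u0)//.
  rewrite lerBlDl (le_trans (smoothed_lip _ _ _ u0 uw t0))// lerD2l.
  have wu : 0 <= w - u by rewrite subr_ge0.
  apply: le_trans (_ : 4 / s * m (4 * s) t * (w - u) <= _); last first.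
    by rewrite ler_wpM2r// lerDl.
  rewrite [leRHS]mulrAC ler_pM//.
  + by rewrite divr_ge0 ?mulr_ge0// ltW.
  + by apply: m_ge0 => //; rewrite mulr_ge0// ltW.
  + rewrite mulrAC ler_wpM2r// ler_pdivrMr// mulrAC ler_pdivlMr//.
    by lra.
  + apply: m_nd => //; [by rewrite mulr_ge0// ltW|lra].
apply/nbhs_ballP; exists (Num.min (s / 2) (e / C)).
  by rewrite /= lt_min !divr_gt0.
move=> u; rewrite /ball/= in_itv/= andbT lt_min => /andP[us2 ue] u0.
have uC : C * `|s - u| <= e by rewrite mulrC -ler_pdivlMr// ltW.
have [su|us] := leP s u.
- have suE : `|s - u| = u - s by rewrite distrC ger0_norm ?subr_ge0.
  rewrite distrC; apply: le_trans uC; rewrite suE in us2 *.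
  by apply: key => //; lra.
- have suE : `|s - u| = s - u by rewrite gtr0_norm ?subr_gt0.
  apply: le_trans uC; rewrite suE in us2 *.
  by apply: key => //; lra.
Qed.

Lemma kl_majorant_classKL : classKL kl_majorant.
Proof.
split=> [t t0|s s0].
  have t1 : 0 < 1 + t by rewrite ltr_pwDl.
  split; last exact: kl_majorant_continuous.
    by rewrite /kl_majorant smoothed0// mul0r addr0.
  move=> s u s0 su; rewrite /kl_majorant ler_ltD ?smoothed_nd ?(ltW su)//.
  by rewrite ltr_pM2r ?invr_gt0.
split=> [t u t0 tu|].
  rewrite /kl_majorant lerD ?smoothed_ni// ler_wpM2l// lef_pV2 ?posrE; lra.
apply/cvgrPdist_le => e e0.
have e2 : 0 < e / 2 by rewrite divr_gt0.
have s20 : 0 <= 2 * s by rewrite mulr_ge0.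
have [T T0 mT] := m_attr (2 * s) (e / 2) s20 e2.
have Q0 : 0 <= s / (e / 2) by rewrite divr_ge0// ltW.
exists (T + s / (e / 2)); split; first exact: num_real.
move=> t Tt; have tT : T <= t by lra.
have t0 : 0 <= t by lra.
have t1 : 0 < 1 + t by rewrite ltr_pwDl.
have st0 : 0 <= s / (1 + t) by rewrite divr_ge0// ltW.
rewrite sub0r normrN /kl_majorant ger0_norm ?addr_ge0 ?smoothed_ge0//.
have h1 : smoothed s t <= e / 2.
  rewrite (le_trans (smoothed_le _ _ s0 t0))// (le_trans _ mT)//.
  exact: m_ni.
have h2 : s / (1 + t) <= e / 2.
  by rewrite ler_pdivrMr// mulrC -ler_pdivrMr//; lra.
lra.
Qed.

End KLMajorant.

(** * Uniform attraction *)

Lemma C1_bound_history {R : realType} {n : nat} (x : R -> 'rV[R]_n) (t a b M : R) :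
  C1_bound (t + a) (t + b) M x -> C1_bound a b M (history x t).
Proof.
move=> [dx mx]; split.
  move=> s /andP[as_ sb]; have [|dxs xM] := dx (t + s); first by rewrite !ltrD2l as_.
  by split; [exact: derivable_history|rewrite derive1_history].
move=> i; rewrite (_ : (fun s => _) = (fun s => derive1 x (t + s) 0 i)); last first.
  by apply/funext => s; rewrite derive1_history.
exact: (measurable_translate_itv _ _ _ (fun s => derive1 x s 0 i)).
Qed.

Section UGAS_GAS.
Context {R : realType} {n : nat} (r : R) (f : (R -> 'rV[R]_n) -> 'rV[R]_n).
Variable X : fun_space R n.
Hypotheses (norm_ge0 : forall x, (0 <= space_norm X x)%E)
  (norm_fin : forall x, carrier X x -> (space_norm X x < +oo)%E).

Lemma UGAS_GAS : UGAS r f X -> GAS r f X.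
Proof.
move=> [sigma [sK sL] sigmaP].
have nf x : carrier X x -> space_norm X x = (fine (space_norm X x))%:E.
  by move=> Xx; rewrite fineK// ge0_fin_numE// norm_fin.
have fn0 x : 0 <= fine (space_norm X x) by exact: fine_ge0.
split.
- move=> e e0; have [s00 s0nd s0c] := sK 0 (lexx 0).
  have [d d0 de] : exists2 d, 0 < d & sigma d 0 <= e.
    move/subspace_continuousP : s0c => /(_ 0); rewrite /= in_itv/= lexx => /(_ isT).
    move=> /cvgrPdist_le/(_ _ e0) /nbhs_ballP[d /= d0 hd].
    have d2 : 0 < d / 2 by rewrite divr_gt0.
    exists (d / 2) => //; have := hd (d / 2); rewrite /ball/= sub0r normrN.
    rewrite gtr0_norm// ltr_pdivrMr// ltr_pMr// ltr1n in_itv/= andbT (ltW d2).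
    move=> /(_ isT isT); rewrite /from_subspace s00 sub0r normrN.
    by move=> /(le_trans (ler_norm _)).
  exists d => //; apply/ereal_supP => _ [t [x0 [t0 Xx0 x0d ->]]].
  apply: le_trans (sigmaP t x0 t0 Xx0) _; rewrite lee_fin.
  apply: le_trans de; rewrite nf// lee_fin in x0d.
  have [smon _] := sL _ (fn0 x0); apply: le_trans (smon 0 t (lexx _) t0) _.
  move: x0d; rewrite le_eqVlt => /predU1P[->//|x0d].
  by rewrite ltW// s0nd.
- move=> x0 Xx0; have [_ s0] := sL _ (fn0 x0).
  apply: (@squeeze_cvge _ _ _ _ (cst 0%E) _
    (fun t => (sigma (fine (space_norm X x0)) t)%:E)).
  + by exists 0; split; [exact: num_real|move=> t /ltW t0; rewrite norm_ge0 sigmaP].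
  + exact: cvg_cst.
  + by apply: cvg_EFin; [exact: nearW|exact: s0].
Qed.

End UGAS_GAS.

Section GAS_UGAS.
Context {R : realType} {n : nat} (r : R) (f : (R -> 'rV[R]_n) -> 'rV[R]_n).
Context (p : \bar R) (X : fun_space R n) (L : R -> R).
Hypotheses (r_gt0 : 0 < r) (f0 : f (cst 0) = 0) (f_lip : lipschitz_with r f L).
Hypotheses (p_gt1 : (1 < p)%E) (XE : phase_space r p X).
Local Notation alpha := (holder_exponent p).
Local Notation Cr := (2 + r `^ (1 - alpha)).
Hypothesis (global_existence : forall x0 : R -> 'rV[R]_n,
  carrier (holder r alpha) x0 -> exists x, solution r f x0 x).
Implicit Types (x y z : R -> 'rV[R]_n) (A M t T e : R).

Let alpha_gt0 : 0 < alpha. Proof. exact: holder_exponent_gt0. Qed.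

Let L_ge0 M : 0 <= M -> 0 <= L M.
Proof. by move=> /f_lip[]. Qed.

Lemma space_in_holder_ball x A : carrier X x -> (space_norm X x <= A%:E)%E ->
  holder_ball r alpha A x.
Proof. by move=> Xx xA; exact: (space_holder_ball _ _ _ r_gt0 p_gt1 XE). Qed.

Lemma holder_ball_solution A x0 : 0 <= A -> holder_ball r alpha A x0 ->
  exists x, solution r f x0 x.
Proof.
by move=> A0 x0A; apply: global_existence; exact: (holder_ball_carrier _ _ _ A).
Qed.

(** For t >= r the state only depends on the solution at positive times, where
    it is C^1; the window has length 2 r because velocities on [t - r, t] depend
    on the states up to r earlier. *)
Lemma smooth_history x0 x t m M : solution r f x0 x -> r <= t ->
  0 <= m -> m <= M -> (forall s, t - 2 * r <= s <= t -> enorm (x s) <= m) ->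
  carrier X (history x t) /\
  (space_norm X (history x t) <= (Cr * ((1 + L M) * m))%:E)%E.
Proof.
move=> sx rt m0 mM xm; have r0 := r_gt0.
have LM0 : 0 <= L M by apply: L_ge0; exact: le_trans mM.
have Lm0 : 0 <= L M * m by rewrite mulr_ge0.
have t0 : 0 <= t by lra.
apply: (C1_in_space _ _ _ r_gt0 p_gt1 XE).
- by rewrite mulr_ge0// addr_ge0.
- exact: history_C0 sx t0.
- apply: C1_bound_history; rewrite addr0.
  have tr : 0 <= t - r by lra.
  have [|dx mx] := solution_C1_bound r f r_gt0 f0 L f_lip x0 x (t - r) t m M sx tr m0 mM.
    by move=> s /andP[? ?]; apply: xm; lra.
  split => // s /dx[? H]; split => //; apply: le_trans H _.
  by rewrite mulrDl mul1r lerDr.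
- move=> s /andP[rs s0]; rewrite mulrDl mul1r; apply: le_trans (_ : m <= _).
    by apply: xm; lra.
  by rewrite lerDl.
Qed.

Lemma history_history x s t : history (history x s) t = history x (s + t).
Proof. by apply/funext => u; rewrite /history addrA. Qed.

Lemma space_norm_phi x0 x t : solution r f x0 x -> 0 <= t ->
  space_norm X (phi r f t x0) = space_norm X (history x t).
Proof.
move=> sx t0; apply: (space_norm_eq r p) => // s /andP[rs _].
exact: (phi_history r f r_gt0 L f_lip _ _ _ _ sx).
Qed.

Lemma LS_solution : LS r f X -> forall e, 0 < e -> exists2 d, 0 < d &
  forall x0 x t, carrier X x0 -> (space_norm X x0 <= d%:E)%E ->
    solution r f x0 x -> 0 <= t -> (space_norm X (history x t) <= e%:E)%E.
Proof.
move=> ls e /ls[d d0 /ereal_supP de]; exists d => // x0 x t Xx0 x0d sx t0.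
rewrite -(space_norm_phi _ _ _ sx t0); apply: de.
by exists t, x0.
Qed.

(** An initial function x0 that is merely Hoelder need not belong to X, but its
    state at time r does, and attraction in X applies from there. *)
Lemma GA_holder : GA r f X -> forall A x0 x e, 0 <= A ->
  holder_ball r alpha A x0 -> solution r f x0 x -> 0 < e ->
  exists2 T, 0 <= T & forall s, T <= s -> enorm (x s) <= e.
Proof.
move=> ga A x0 x e A0 x0A sx e0; have r0 := r_gt0.
have [B B0 xB] := within_bounded _ _ _ (solution_continuous r f x0 x (- r) r sx (lexx _)).
have [|Xz _] := smooth_history x0 x r B B sx (lexx _) B0 (lexx _).
  by move=> s /andP[? ?]; apply: xB; lra.
have sz := solution_history r f _ _ _ sx (ltW r_gt0).
have e_nbhs : nbhs 0%E [set y : \bar R | (y < e%:E)%E].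
  by apply: open_ereal_lt'; rewrite lte_fin.
have [T1 [_ hT1]] := ga _ Xz _ e_nbhs.
exists (Num.max 0 (T1 + 1) + r); first by rewrite addr_ge0 ?(ltW r_gt0)// le_max lexx.
move=> s Ts.
have s0 : 0 <= s - r by rewrite subr_ge0 (le_trans _ Ts)// lerDr le_max lexx.
have T1s : T1 < s - r.
  rewrite ltrBrDr; apply: lt_le_trans Ts.
  by rewrite ltrD2r lt_max ltrDl ltr01 orbT.
have := ltW (hT1 _ T1s).
rewrite (space_norm_phi _ _ _ sz s0) history_history.
move=> /(space_norm_sup _ _ _ XE) /(_ 0).
rewrite lexx oppr_le0 (ltW r_gt0) => /(_ isT).
by rewrite /history addr0 subrKC.
Qed.

Hypotheses (ls : LS r f X) (ga : GA r f X).

(** Around each x0 in the Hoelder ball, continuous dependence up to the time T1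
    at which the solution has been small over a window of length 2 r makes the
    neighbouring solutions small over that window too; by smoothing they enter
    at T1 the X-ball of radius d from which stability keeps them below e. *)
Lemma uniform_attraction A e : 0 <= A -> 0 < e -> exists2 T, 0 <= T &
  forall x0 x t, carrier X x0 -> (space_norm X x0 <= A%:E)%E ->
    solution r f x0 x -> T <= t -> (space_norm X (history x t) <= e%:E)%E.
Proof.
move=> A0 e0; have r0 := r_gt0.
have [d d0 hd] := LS_solution ls e e0.
have L1 : 0 <= L 1 by exact: L_ge0.
pose K := Cr * (1 + L 1).
have K0 : 0 < K by rewrite mulr_gt0 ?Cr_gt0// ltr_pwDl.
pose m := Num.min 1 (d / K).
have m0 : 0 < m by rewrite lt_min ltr01 divr_gt0.
have m1 : m <= 1 by rewrite ge_min lexx.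
have Km : Cr * ((1 + L 1) * m) <= d.
  by rewrite mulrA mulrC -ler_pdivlMr// ge_min lexx orbT.
have m2 : 0 < m / 2 by rewrite divr_gt0.
have [] := holder_ball_cover r alpha alpha_gt0 A (fun y0 T =>
  forall y, solution r f y0 y -> forall t, T <= t ->
  (space_norm X (history y t) <= e%:E)%E) A0; last first.
  move=> T T0 hT; exists T => // x0 x t Xx0 x0A sx.
  exact: hT (space_in_holder_ball _ _ Xx0 x0A) x sx t.
move=> x0 x0A; have [x sx] := holder_ball_solution _ _ A0 x0A.
have [T0 T00 xT0] := GA_holder ga _ _ _ _ A0 x0A sx m2.
(* On [T0, T1], a window of length 2 r, the solution x is at most m / 2. *)
pose T1 := T0 + 2 * r.
have T10 : 0 <= T1 by rewrite /T1; lra.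
have [B B0 xB] := within_bounded _ _ _ (solution_continuous r f x0 x (- r) T1 sx (lexx _)).
pose E := expR (L (B + 1) * T1).
have E0 : 0 < E by exact: expR_gt0.
pose eta := m / 2 / E.
have eta0 : 0 < eta by rewrite divr_gt0.
have etaE : eta * E = m / 2 by rewrite divfK// gt_eqF.
exists (eta / 2), T1; split; first by rewrite divr_gt0.
move=> y0 y0A xy0 T' TT' y sy t tT'.
have xy := continuous_dependence r f r_gt0 L f_lip x0 y0 x y B T1 (eta / 2) eta
  sx sy B0 T10 xB xy0.
have {}xy s : - r <= s <= T1 -> enorm (x s - y s) <= m / 2.
  rewrite -etaE; apply: xy; last by rewrite -/E etaE; lra.
  by rewrite ltr_pdivrMr// ltr_pMr// ltr1n.
have rT1 : r <= T1 by rewrite /T1; lra.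
have [|Xz zd] := smooth_history y0 y T1 m 1 sy rT1 (ltW m0) m1.
  move=> s /andP[Ts sT]; have xs : enorm (x s) <= m / 2 by apply: xT0; rewrite /T1 in Ts; lra.
  have sI : - r <= s <= T1 by rewrite sT andbT; rewrite /T1 in Ts; lra.
  by have := ler_enormB (x s) (x s - y s); rewrite subKr; have := xy s sI; lra.
have sz := solution_history r f _ _ _ sy T10.
have tT1 : 0 <= t - T1 by rewrite subr_ge0 (le_trans TT').
have zd' : (space_norm X (history y T1) <= d%:E)%E.
  by apply: le_trans zd _; rewrite lee_fin.
have := hd _ _ _ Xz zd' sz tT1.
by rewrite history_history subrKC.
Qed.

(** After the attraction time of e = 1 the norm is at most 1.  Before it, the
    covering argument bounds the solutions uniformly, and this bounds their
    states in X by gluing up to time r and by smoothing later. *)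
Lemma uniform_bound A : 0 <= A -> exists2 B, 0 <= B &
  forall x0 x t, carrier X x0 -> (space_norm X x0 <= A%:E)%E ->
    solution r f x0 x -> 0 <= t -> (space_norm X (history x t) <= B%:E)%E.
Proof.
move=> A0; have r0 := r_gt0.
have [T T0 xT] := uniform_attraction A 1 A0 ltr01.
pose T1 := T + r.
have T10 : 0 <= T1 by rewrite /T1; lra.
have [] := holder_ball_cover r alpha alpha_gt0 A (fun y0 B =>
  forall y, solution r f y0 y -> forall s, - r <= s <= T1 -> enorm (y s) <= B) A0.
  move=> x0 x0A; have [x sx] := holder_ball_solution _ _ A0 x0A.
  have [B B0 xB] := within_bounded _ _ _ (solution_continuous r f x0 x (- r) T1 sx (lexx _)).
  pose E := expR (L (B + 1) * T1).
  have E0 : 0 < E by exact: expR_gt0.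
  have EE : E^-1 * E = 1 by rewrite mulVf// gt_eqF.
  exists (E^-1 / 2), (B + 1); split; first by rewrite divr_gt0// invr_gt0.
  move=> y0 y0A xy0 B' BB' y sy s sI.
  have xy := continuous_dependence r f r_gt0 L f_lip x0 y0 x y B T1 (E^-1 / 2) E^-1
    sx sy B0 T10 xB xy0.
  have {}xy : enorm (x s - y s) <= 1.
    rewrite -EE; apply: xy => //; last by rewrite -/E EE.
    by rewrite ltr_pdivrMr// ltr_pMr ?invr_gt0// ltr1n.
  by have := ler_enormB (x s) (x s - y s); rewrite subKr; have := xB s sI; lra.
move=> B B0 hB.
have LB0 : 0 <= L B by exact: L_ge0.
pose M := (1 + L B) * B.
have M0 : 0 <= M by rewrite mulr_ge0// addr_ge0.
have BM : B <= M by rewrite /M mulrDl mul1r lerDl mulr_ge0.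
have LBM : L B * B <= M by rewrite /M mulrDl mul1r lerDr.
have C0 := Cr_gt0 r p.
have CM : 0 <= Cr * M by rewrite mulr_ge0// ltW.
have CA : 0 <= Cr * A by rewrite mulr_ge0// ltW.
exists (1 + Cr * (A + M)); first by rewrite mulrDr; lra.
move=> x0 x t Xx0 x0A sx t0.
have xB : forall s, - r <= s <= T1 -> enorm (x s) <= B.
  exact: hB (space_in_holder_ball _ _ Xx0 x0A) x sx.
have [Tt|tT] := leP T t.
  by apply: le_trans (xT _ _ _ Xx0 x0A sx Tt) _; rewrite lee_fin mulrDr; lra.
have [tr|rt] := leP t r.
  apply: (@le_trans _ _ (Cr * (A + M))%:E); last by rewrite lee_fin; lra.
  have [xx0 _ _ _] := sx.
  apply: (history_space_bound r p X r_gt0 p_gt1 XE x0) => //.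
  - by rewrite t0.
  - exact: solution_continuous sx (lexx _).
  - have [|dx mx] := solution_C1_bound r f r_gt0 f0 L f_lip x0 x 0 t B B sx (lexx _) B0 (lexx _).
      by move=> s /andP[? ?]; apply: xB; rewrite /T1; lra.
    by split => // s /dx[? H]; split => //; exact: le_trans H _.
  - by move=> s /andP[? ?]; apply: le_trans BM; apply: xB; rewrite /T1; lra.
have [|_ H] := smooth_history x0 x t B B sx (ltW rt) B0 (lexx _).
  by move=> s /andP[? ?]; apply: xB; rewrite /T1; lra.
by apply: le_trans H _; rewrite -/M lee_fin mulrDr; lra.
Qed.

Lemma space_solution x0 : carrier X x0 -> exists x, solution r f x0 x.
Proof.
move=> Xx0.
have n0 := space_norm_ge0 r p X r_gt0 XE x0.
have nf : space_norm X x0 = (fine (space_norm X x0))%:E.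
  rewrite fineK// ge0_fin_numE//; exact: (space_norm_fin r p X XE).
apply: (holder_ball_solution (fine (space_norm X x0))); first exact: fine_ge0.
by apply: space_in_holder_ball => //; rewrite -nf.
Qed.

(** The value 0 is added so that the supremum is nonnegative. *)
Definition overshoots (s t : R) : set R :=
  [set y | y = 0 \/ exists tau x0 x, [/\ t <= tau, carrier X x0,
     (space_norm X x0 <= s%:E)%E, solution r f x0 x &
     space_norm X (history x tau) = y%:E]].

Definition overshoot (s t : R) : R := sup (overshoots s t).

Lemma overshoots_bounded s t B : 0 <= B ->
  (forall x0 x tau, carrier X x0 -> (space_norm X x0 <= s%:E)%E ->
    solution r f x0 x -> t <= tau -> (space_norm X (history x tau) <= B%:E)%E) ->
  ubound (overshoots s t) B.
Proof.
move=> B0 H y [->//|[tau [x0 [x [tt Xx0 x0s sx xy]]]]].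
by rewrite -lee_fin -xy; exact: H sx tt.
Qed.

Lemma overshoots0 s t : overshoots s t 0. Proof. by left. Qed.

Lemma overshoot_le s t B : ubound (overshoots s t) B -> overshoot s t <= B.
Proof. by move=> H; apply: ge_sup => //; exists 0; exact: overshoots0. Qed.

Lemma overshoots_sup s t : 0 <= s -> 0 <= t -> has_ubound (overshoots s t).
Proof.
move=> s0 t0; have [B B0 hB] := uniform_bound s s0.
exists B; apply: overshoots_bounded => // x0 x tau Xx0 x0s sx tt.
by apply: hB Xx0 x0s sx _; exact: le_trans tt.
Qed.

Lemma overshoot_mono s s' t t' : 0 <= s' -> s <= s' -> 0 <= t' -> t' <= t ->
  overshoot s t <= overshoot s' t'.
Proof.
move=> s0 ss t0 tt; apply: overshoot_le => y ys; apply: ub_le_sup.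
  exact: overshoots_sup.
case: ys => [->|[tau [x0 [x [h1 h2 h3 h4 h5]]]]]; first by left.
right; exists tau, x0, x; split => //; first exact: le_trans h1.
by apply: le_trans h3 _; rewrite lee_fin.
Qed.

Lemma GAS_UGAS : UGAS r f X.
Proof.
have over_ge0 s t : 0 <= s -> 0 <= t -> 0 <= overshoot s t.
  by move=> s0 t0; apply: ub_le_sup; [exact: overshoots_sup|exact: overshoots0].
have over_small e : 0 < e -> exists2 d, 0 < d & overshoot d 0 <= e.
  move=> e0; have [d d0 hd] := LS_solution ls e e0.
  exists d => //; apply/overshoot_le/overshoots_bounded; first exact: ltW.
  by move=> x0 x tau Xx0 x0s sx; exact: (hd x0 x tau Xx0 x0s sx).
exists (kl_majorant overshoot).
  apply: kl_majorant_classKL => //.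
  - by move=> s s' t s0 ss t0; apply: overshoot_mono => //; exact: le_trans s0 ss.
  - by move=> s t t' s0 t0 tt; exact: overshoot_mono.
  - move=> s e s0 e0; have [T T0 hT] := uniform_attraction s e s0 e0.
    exists T => //; apply/overshoot_le/overshoots_bounded; first exact: ltW.
    by move=> x0 x tau Xx0 x0s sx; exact: (hT x0 x tau Xx0 x0s sx).
move=> t x0 t0 Xx0; have [x sx] := space_solution x0 Xx0.
have n0 := space_norm_ge0 r p X r_gt0 XE.
have x0E : space_norm X x0 = (fine (space_norm X x0))%:E.
  rewrite fineK// ge0_fin_numE//; exact: (space_norm_fin r p X XE).
have s0 : 0 <= fine (space_norm X x0) by exact: fine_ge0.
rewrite (space_norm_phi x0 x t sx t0).
have [B _ hB] := uniform_bound _ s0.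
have xB : (space_norm X (history x t) <= B%:E)%E by apply: hB sx t0; rewrite // -x0E.
have xE : space_norm X (history x t) = (fine (space_norm X (history x t)))%:E.
  by rewrite fineK// ge0_fin_numE// (le_lt_trans xB) ?ltry.
rewrite xE lee_fin.
apply: le_trans (kl_majorant_ge overshoot _ _ _ _ _ _ s0 t0) => //.
- by apply: ub_le_sup; [exact: overshoots_sup|right; exists t, x0, x; split => //; rewrite -x0E].
- by move=> s s' u s0' ss u0; apply: overshoot_mono => //; exact: le_trans s0' ss.
- by move=> s u u' s0' u0 uu; exact: overshoot_mono.
Qed.

End GAS_UGAS.

Theorem theorem3 (R : realType) (n : nat) (r : R)
    (f : (R -> 'rV[R]_n) -> 'rV[R]_n) (p : \bar R) (X : fun_space R n)
    (r_gt0 : 0 < r) (f0 : f (cst 0) = 0) (f_lip : lipschitz_on_bounded r f)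
    (p_gt1 : (1 < p)%E)
    (XE : X = sobolev r p \/ X = holder r (holder_exponent p))
    (global_existence : forall x0 : R -> 'rV[R]_n,
       carrier (holder r (holder_exponent p)) x0 -> exists x, solution r f x0 x) :
  GAS r f X <-> UGAS r f X.
Proof.
have [L Lf] := lipschitz_on_boundedP r f f_lip.
split=> [[ls ga]|].
  exact: (GAS_UGAS r f p X L).
apply: UGAS_GAS; first exact: (space_norm_ge0 r p X r_gt0 XE).
exact: (space_norm_fin r p X XE).
Qed.
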